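(* Let $R$ be a commutative Noetherian local ring with maximal ideal $\mathfrak m$ and $\dim R=n$, and let $\mathfrak a$ be an ideal of $R$. Let $M$ be a finitely generated $R$-module and $X$ an arbitrary $R$-module such that $H^j_{\mathfrak a}(X)=0$ for all $j\ne n-1,n$. Then $\operatorname{Ass}_R(H^i_{\mathfrak a}(M,X))$ is finite for all $i$.
   Context: $H^i_{\mathfrak a}(M,X)=\varinjlim_{k}\operatorname{Ext}^i_R(M/\mathfrak a^kM,X)$ is the $i$-th generalized local cohomology module, and $H^i_{\mathfrak a}(X)=H^i_{\mathfrak a}(R,X)$ is ordinary local cohomology. *)

(* Defs.v *)
From HB Require Import structures.
From mathcomp Require Import all_boot all_algebra generic_quotient ring_quotient.
From mathcomp Require Import boolp classical_sets functions cardinality.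
From mathcomp Require Import freeg.

Set Implicit Arguments.
Unset Strict Implicit.
Unset Printing Implicit Defensive.

Import GRing.Theory.
Local Open Scope ring_scope.
Local Open Scope quotient_scope.
Local Open Scope classical_set_scope.

(* Submodules are MathComp's [submodClosed V]; an ideal of R, proper or not, is
   a [submodClosed R^o]. MathComp's [idealr R] are the proper ideals and
   [prime_idealr R] the prime ideals. *)

Section Submodules.
Variables (R : comNzRingType) (V : lmodType R).
Implicit Types (S : submodClosed V) (x y : V).

Section Pack.
Variable P : set V.
Hypotheses (P0 : P 0) (PD : forall x y, P x -> P y -> P (x + y)).
Hypothesis PZ : forall r x, P x -> P (r *: x).

Let mem_P : V -> bool := fun x => `[< P x >].

Fact mem_P_closed : subsemimod_closed mem_P.
Proof.
split; first split; first exact/asboolP.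
- by move=> x y /asboolP Px /asboolP Py; apply/asboolP/PD.
- by move=> r x /asboolP Px; apply/asboolP/PZ.
Qed.

Let mem_P_isSubmod := GRing.isSubmodClosed.Build R V mem_P mem_P_closed.

Definition mkSubmod : submodClosed V := HB.pack mem_P mem_P_isSubmod.

Lemma mkSubmodP x : reflect (P x) (x \in mkSubmod).
Proof. exact: asboolP. Qed.

End Pack.

Definition submod_span (A : set V) : submodClosed V.
Proof.
refine (@mkSubmod
  [set x | forall S : submodClosed V, A `<=` [set` S] -> x \in S] _ _ _) => /=.
- by move=> S _; exact: rpred0.
- by move=> x y xA yA S AS; rewrite rpredD ?xA ?yA.
- by move=> r x xA S AS; rewrite rpredZ ?xA.
Defined.

Lemma sub_span (A : set V) x : A x -> x \in submod_span A.
Proof. by move=> Ax; apply/mkSubmodP => S; apply. Qed.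

Lemma span_sub (A : set V) S : A `<=` [set` S] -> {subset submod_span A <= S}.
Proof. by move=> AS x /mkSubmodP; apply. Qed.

Definition submod_type S : Type := {x : V | x \in S}.

HB.instance Definition _ S :=
  [isSub of submod_type S for @sval V (fun x => x \in S)].
HB.instance Definition _ S := [Choice of submod_type S by <:].
HB.instance Definition _ S := [SubChoice_isSubLmodule of submod_type S by <:].

(* [submodClosed] only records closure under sums and scaling, whereas
   [Quotient.quot] asks for a [zmodClosed] predicate. *)
Let zmod_of_submod S : zmodClosed V :=
  HB.pack (fun x => x \in S)
    (GRing.isZmodClosed.Build V (fun x => x \in S)
       (GRing.submod_closedB (submodClosedP S))).

Definition quot_type S : Type := Quotient.quot (zmod_of_submod S).

HB.instance Definition _ S :=
  GRing.Zmodule.copy (quot_type S) (Quotient.quot (zmod_of_submod S)).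
HB.instance Definition _ S :=
  Quotient.copy (quot_type S) (Quotient.quot (zmod_of_submod S)).

Definition quot_proj S : V -> quot_type S :=
  \pi_(Quotient.quot (zmod_of_submod S)).

Lemma quotP S x y : (quot_proj S x == quot_proj S y) = (x - y \in S).
Proof. exact/esym/(Quotient.idealrBE (zmod_of_submod S)). Qed.

Lemma quot_projK S : cancel repr (quot_proj S).
Proof. exact: reprK. Qed.

Fact quot_proj_is_zmod_morphism S : zmod_morphism (quot_proj S).
Proof. exact: pi_is_zmod_morphism (Quotient.quot (zmod_of_submod S)). Qed.

HB.instance Definition _ S :=
  GRing.isZmodMorphism.Build V (quot_type S) (quot_proj S)
    (quot_proj_is_zmod_morphism S).

Definition quot_scale S (r : R) (u : quot_type S) : quot_type S :=
  quot_proj S (r *: repr u).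

Lemma quot_scale_proj S r x : quot_scale r (quot_proj S x) = quot_proj S (r *: x).
Proof. by apply/eqP; rewrite quotP -scalerBr rpredZ// -quotP quot_projK. Qed.

Fact quot_scalerA S r s (u : quot_type S) :
  quot_scale r (quot_scale s u) = quot_scale (r * s) u.
Proof. by rewrite -(quot_projK u) !quot_scale_proj scalerA. Qed.

Fact quot_scale1r S : left_id 1 (@quot_scale S).
Proof. by move=> u; rewrite -(quot_projK u) quot_scale_proj scale1r. Qed.

Fact quot_scalerDr S : right_distributive (@quot_scale S) +%R.
Proof.
move=> r u v; rewrite -(quot_projK u) -(quot_projK v) -raddfD.
by rewrite !quot_scale_proj scalerDr raddfD.
Qed.

Fact quot_scalerDl S (u : quot_type S) :
  {morph (@quot_scale S)^~ u : r s / r + s}.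
Proof.
by move=> r s; rewrite -(quot_projK u) !quot_scale_proj scalerDl raddfD.
Qed.

HB.instance Definition _ S :=
  GRing.Zmodule_isLmodule.Build R (quot_type S) (@quot_scalerA S)
    (@quot_scale1r S) (@quot_scalerDr S) (@quot_scalerDl S).

Fact quot_proj_is_scalable S : scalable (quot_proj S).
Proof. by move=> r x; rewrite -quot_scale_proj. Qed.

HB.instance Definition _ S :=
  GRing.isScalable.Build R V (quot_type S) *:%R (quot_proj S)
    (quot_proj_is_scalable S).

End Submodules.

Section LinearMaps.
Variables (R : comNzRingType) (V W : lmodType R) (f : {linear V -> W}).

Definition lin_ker : submodClosed V.
Proof.
refine (@mkSubmod _ _ [set x | f x = 0] _ _ _) => /=.
- exact: linear0.
- by move=> x y fx fy; rewrite linearD fx fy addr0.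
- by move=> r x fx; rewrite linearZ/= fx scaler0.
Defined.

Definition lin_im : submodClosed W.
Proof.
refine (@mkSubmod _ _ (range f) _ _ _).
- by exists 0 => //; exact: linear0.
- by move=> _ _ [x _ <-] [y _ <-]; exists (x + y) => //; exact: linearD.
- by move=> r _ [x _ <-]; exists (r *: x) => //; exact: linearZ.
Defined.

Definition submod_preim (T : submodClosed W) : submodClosed V.
Proof.
refine (@mkSubmod _ _ [set x | f x \in T] _ _ _) => /=.
- by rewrite linear0 rpred0.
- by move=> x y fx fy; rewrite linearD rpredD.
- by move=> r x fx; rewrite linearZ/= rpredZ.
Defined.

Section Restrict.
Variables (S : submodClosed V) (T : submodClosed W).
Implicit Types fST : {in S, forall x, f x \in T}.

Definition sub_map fST (x : submod_type S) : submod_type T :=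
  Sub (f (val x)) (fST _ (valP x)).

Fact sub_map_is_linear fST : linear (sub_map fST).
Proof. by move=> r x y; apply: val_inj; rewrite /= !linearP. Qed.

HB.instance Definition _ fST :=
  GRing.isLinear.Build R (submod_type S) (submod_type T) *:%R (sub_map fST)
    (sub_map_is_linear fST).

Definition quot_map of {in S, forall x, f x \in T} :
  quot_type S -> quot_type T := fun u => quot_proj T (f (repr u)).

Lemma quot_map_proj fST x : quot_map fST (quot_proj S x) = quot_proj T (f x).
Proof. by apply/eqP; rewrite quotP -linearB fST// -quotP quot_projK. Qed.

Fact quot_map_is_linear fST : linear (quot_map fST).
Proof.
move=> r u v; rewrite -(quot_projK u) -(quot_projK v) -linearP.
by rewrite !quot_map_proj !linearP.
Qed.

HB.instance Definition _ fST :=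
  GRing.isLinear.Build R (quot_type S) (quot_type T) *:%R (quot_map fST)
    (quot_map_is_linear fST).

End Restrict.
End LinearMaps.

Section Hom.
Variables (R : comNzRingType) (V W : lmodType R).

Definition linear_funs : submodClosed (V -> W).
Proof.
refine (@mkSubmod _ _ [set f | linear f] _ _ _) => /=.
- by move=> r x y; change (0 = r *: 0 + 0 :> W); rewrite scaler0 addr0.
- move=> f g lf lg r x y.
  change (f (r *: x + y) + g (r *: x + y) = r *: (f x + g x) + (f y + g y)).
  by rewrite lf lg scalerDr addrACA.
- move=> s f lf r x y.
  change (s *: f (r *: x + y) = r *: (s *: f x) + s *: f y).
  by rewrite lf scalerDr !scalerA mulrC.
Defined.

Definition Hom_mod : lmodType R := submod_type linear_funs.

End Hom.

Section Precomposition.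
Variables (R : comNzRingType) (V W X : lmodType R) (f : {linear V -> W}).

Fact precomp_subproof (g : Hom_mod W X) : \val g \o f \in linear_funs V X.
Proof.
by apply/mkSubmodP => r x y /=; rewrite linearP (mkSubmodP _ _ _ _ (valP g)).
Qed.

Definition precomp (g : Hom_mod W X) : Hom_mod V X := Sub (\val g \o f) (precomp_subproof g).

Fact precomp_is_linear : linear precomp.
Proof. by move=> r g h; apply/val_inj. Qed.

HB.instance Definition _ :=
  GRing.isLinear.Build R (Hom_mod W X) (Hom_mod V X) *:%R precomp precomp_is_linear.

End Precomposition.

Arguments precomp {R V W} X f g.

(* [free_mod K] has basis the elements <<k>>, k in K; [free_aug] maps
   [free_mod V] onto V by <<v>> |-> v. *)
Section FreeModule.
Variable R : comNzRingType.
Implicit Types (K : choiceType) (V W : lmodType R).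

Definition free_mod K : lmodType R := {freeg K / R}.

Fact fglift_is_linear K W (f : K -> W) : linear (fglift f : free_mod K -> W).
Proof.
pose F := fglift f : free_mod K -> W.
pose aF := GRing.isZmodMorphism.Build (free_mod K) W F (lift_is_additive f).
pose FA : {additive free_mod K -> W} := HB.pack F aF.
have Fsum s (g : K -> free_mod K) : F (\sum_(z <- s) g z) = \sum_(z <- s) F (g z).
  exact: (raddf_sum FA).
have FZ r x : F (r *: x) = r *: F x.
  rewrite -[in RHS](freeg_sumE x) !Fsum scaler_sumr.
  by apply: eq_bigr => z _; rewrite /F !liftU scalerA.
by move=> r x y; rewrite -[LHS]/(F (r *: x + y)) -[RHS]/(r *: F x + F y) -FZ; exact: (raddfD FA).
Qed.

HB.instance Definition _ K W (f : K -> W) :=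
  GRing.isLinear.Build R (free_mod K) W *:%R (fglift f : free_mod K -> W)
    (fglift_is_linear f).

Lemma free_ext K W (f g : {linear free_mod K -> W}) :
  (forall k, f << k >> = g << k >>) -> f =1 g.
Proof.
move=> fg x; rewrite -(freeg_sumE x) !linear_sum; apply: eq_bigr => k _.
have -> : << coeff k x *g k >> = coeff k x *: (<< k >> : free_mod K).
  by apply/eqP/freeg_eqP => l; rewrite coeffZ !coeffU mul1r.
by rewrite !linearZ/= fg.
Qed.

Definition free_aug V : free_mod V -> V := fglift id.
HB.instance Definition _ V := GRing.Linear.on (@free_aug V).

Definition free_map V W (f : V -> W) : free_mod V -> free_mod W :=
  fglift (fun v => << f v >>).
HB.instance Definition _ V W (f : V -> W) := GRing.Linear.on (free_map f).

Lemma free_augU V (v : V) : free_aug << v >> = v.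
Proof. by rewrite /free_aug liftU scale1r. Qed.

Lemma free_mapU V W (f : V -> W) v : free_map f << v >> = << f v >>.
Proof. by rewrite /free_map liftU scale1r. Qed.

Lemma free_aug_nat V W (f : {linear V -> W}) x :
  free_aug (free_map f x) = f (free_aug x).
Proof.
apply: (free_ext (f := @free_aug W \o free_map f) (g := f \o @free_aug V)) => v.
by rewrite /= free_mapU !free_augU.
Qed.

End FreeModule.

(* The standard free resolution ... -> free_mod (syz 1 M) -> free_mod (syz 0 M) -> M,
   where syz 0 M = M and syz (i+1) M is the kernel of free_mod (syz i M) -> syz i M.
   It is functorial in M. *)
Section Resolution.
Variable R : comNzRingType.
Implicit Types M N : lmodType R.

Fixpoint syz (i : nat) M : lmodType R :=
  if i is j.+1 then submod_type (lin_ker (@free_aug R (syz j M))) else M.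

Definition res i M : lmodType R := free_mod R (syz i M).

Definition res_diff i M : res i.+1 M -> res i M := val \o @free_aug R (syz i.+1 M).
HB.instance Definition _ i M := GRing.Linear.on (@res_diff i M).

Lemma free_aug_surj M (x : M) : exists y : free_mod R M, free_aug y = x.
Proof. by exists << x >>; exact: free_augU. Qed.

Lemma res_exact0 M (x : res 0 M) :
  free_aug x = 0 <-> exists y, res_diff y = x.
Proof.
split=> [x0|[y <-]]; last exact: (mkSubmodP _ _ _ _ (valP (free_aug y))).
have xk : x \in lin_ker (@free_aug R M) by apply/mkSubmodP.
have [y yx] := free_aug_surj (Sub x xk : syz 1 M).
by exists y; rewrite -[LHS]/(val (free_aug y)) yx.
Qed.

Lemma res_exact i M (x : res i.+1 M) :
  res_diff x = 0 <-> exists y, res_diff y = x.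
Proof.
have -> : (res_diff x = 0) = (free_aug x = 0).
  apply/propext; split=> [x0|x0]; first exact: val_inj.
  by change (val (free_aug x) = 0); rewrite x0.
split=> [x0|[y <-]]; last exact: (mkSubmodP _ _ _ _ (valP (free_aug y))).
have xk : x \in lin_ker (@free_aug R (syz i.+1 M)) by apply/mkSubmodP.
have [y yx] := free_aug_surj (Sub x xk : syz i.+2 M).
by exists y; rewrite -[LHS]/(val (free_aug y)) yx.
Qed.

Fact syz_map_subproof M N (f : {linear M -> N}) :
  {in lin_ker (@free_aug R M), forall x, free_map f x \in lin_ker (@free_aug R N)}.
Proof.
move=> x /mkSubmodP x0; apply/mkSubmodP.
change (free_aug (free_map f x) = 0); rewrite free_aug_nat.
by change (free_aug x = 0) in x0; rewrite x0 linear0.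
Qed.

Fixpoint syz_map i M N (f : {linear M -> N}) : {linear syz i M -> syz i N} :=
  if i is j.+1 then sub_map (syz_map_subproof (syz_map j f)) else f.

Definition res_map i M N (f : {linear M -> N}) : {linear res i M -> res i N} :=
  free_map (syz_map i f).

Lemma res_map_diff i M N (f : {linear M -> N}) x :
  res_map i f (res_diff x) = res_diff (res_map i.+1 f x).
Proof.
rewrite -[RHS]/(val (free_aug (free_map (syz_map i.+1 f) x))) free_aug_nat.
by [].
Qed.

End Resolution.

(* Ext^i_R(M, X) is the i-th cohomology of Hom_R(res _ M, X). *)
Section Ext.
Variables (R : comNzRingType) (X : lmodType R).
Implicit Types M N : lmodType R.

Definition cocycles i M : submodClosed (Hom_mod (res i M) X) :=
  lin_ker (precomp X (@res_diff R i M)).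

Definition coboundaries i M : submodClosed (Hom_mod (res i M) X) :=
  if i is j.+1 return submodClosed (Hom_mod (res i M) X)
  then lin_im (precomp X (@res_diff R j M)) else submod_span set0.

Definition coboundaries_in i M : submodClosed (submod_type (cocycles i M)) :=
  submod_preim (val : submod_type (cocycles i M) -> Hom_mod (res i M) X) (coboundaries i M).

Definition Ext i M : lmodType R := quot_type (coboundaries_in i M).

Section Functoriality.
Variables (i : nat) (M N : lmodType R) (f : {linear M -> N}).

Fact cocycle_map_subproof :
  {in cocycles i N, forall z, precomp X (res_map i f) z \in cocycles i M}.
Proof.
move=> z /mkSubmodP z0; apply/mkSubmodP.
change (precomp X (@res_diff R i N) z = 0) in z0.
change (precomp X (@res_diff R i M) (precomp X (res_map i f) z) = 0).
apply: val_inj; apply: funext => x.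
rewrite -[LHS]/(val z (res_map i f (res_diff x))) res_map_diff.
by rewrite -[LHS]/(val (precomp X (@res_diff R i N) z) _) z0.
Qed.

Definition cocycle_map :
    {linear submod_type (cocycles i N) -> submod_type (cocycles i M)} :=
  sub_map cocycle_map_subproof.

Fact coboundary_map_subproof :
  {in coboundaries i N, forall z, precomp X (res_map i f) z \in coboundaries i M}.
Proof.
case: i => [|j] z.
- move=> z0; have -> : z = 0; last by rewrite linear0 rpred0.
  have sub0 : set0 `<=` [set` lin_ker (@idfun (Hom_mod (res 0 N) X))] by [].
  by have /mkSubmodP := span_sub sub0 z0.
- move=> /mkSubmodP[y _ <-]; apply/mkSubmodP; exists (precomp X (res_map j f) y) => //.
  apply: val_inj; apply: funext => x.
  rewrite -[LHS]/(val y (res_map j f (res_diff x))) res_map_diff.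
  by [].
Qed.

Fact Ext_map_subproof : {in coboundaries_in i N, forall z,
  cocycle_map z \in coboundaries_in i M}.
Proof.
by move=> z /mkSubmodP zB; apply/mkSubmodP; exact: (coboundary_map_subproof zB).
Qed.

Definition Ext_map : {linear Ext i N -> Ext i M} :=
  quot_map (f := cocycle_map) Ext_map_subproof.

End Functoriality.
End Ext.

(* The direct limit of E 0 -> E 1 -> ..., presented by the generators (k, x),
   x in E k, subject to additivity and linearity in x and to
   (k, x) = (k + 1, phi k x). *)
Section DirectLimit.
Variables (R : comNzRingType) (E : nat -> lmodType R).
Variable phi : forall k, {linear E k -> E k.+1}.

Definition dlim_gen k (x : E k) : free_mod R {k : nat & E k} :=
  << existT (fun k => E k : Type) k x >>.

Definition dlim_rel : set (free_mod R {k : nat & E k}) :=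
  [set u | exists k (r : R) (x y : E k),
     u = dlim_gen (r *: x + y) - (r *: dlim_gen x + dlim_gen y)] `|`
  [set u | exists k (x : E k), u = dlim_gen x - dlim_gen (phi k x)].

Definition dlim : lmodType R := quot_type (submod_span dlim_rel).

Definition dlim_in k (x : E k) : dlim := quot_proj _ (dlim_gen x).

Fact dlim_in_is_linear k : linear (@dlim_in k).
Proof.
move=> r x y; rewrite /dlim_in -linearP; apply/eqP; rewrite quotP.
by apply: sub_span; left; exists k, r, x, y.
Qed.

HB.instance Definition _ k :=
  GRing.isLinear.Build R (E k) dlim *:%R (@dlim_in k) (@dlim_in_is_linear k).

Lemma dlim_in_phi k (x : E k) : dlim_in (phi k x) = dlim_in x.
Proof.
by apply/eqP; rewrite eq_sym quotP; apply: sub_span; right; exists k, x.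
Qed.

Lemma dlim_ext (L : lmodType R) (h h' : {linear dlim -> L}) :
  (forall k (x : E k), h (dlim_in x) = h' (dlim_in x)) -> h =1 h'.
Proof.
move=> hh' u; rewrite -(quot_projK u).
pose q := quot_proj (submod_span dlim_rel).
by apply: (free_ext (f := h \o q) (g := h' \o q)) => -[k x]; exact: hh'.
Qed.

Lemma dlim_univ (L : lmodType R) (g : forall k, {linear E k -> L}) :
  (forall k x, g k.+1 (phi k x) = g k x) ->
  exists h : {linear dlim -> L}, forall k (x : E k), h (dlim_in x) = g k x.
Proof.
move=> gphi.
pose G : {linear free_mod R {k : nat & E k} -> L} :=
  fglift (fun p : {k : nat & E k} => g (tag p) (tagged p)).
have Ggen k (x : E k) : G (dlim_gen x) = g k x.
  by rewrite [LHS]liftU scale1r.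
have G0 : {subset submod_span dlim_rel <= lin_ker G}.
  apply: span_sub => _ [[k [r [x [y ->]]]]|[k [x ->]]]; apply/mkSubmodP.
  - change (G (dlim_gen (r *: x + y) - (r *: dlim_gen x + dlim_gen y)) = 0).
    by rewrite linearB linearP !Ggen linearP subrr.
  - change (G (dlim_gen x - dlim_gen (phi k x)) = 0).
    by rewrite linearB !Ggen gphi subrr.
pose h (u : dlim) := G (repr u).
have hE x : h (quot_proj _ x) = G x.
  apply/eqP; rewrite -subr_eq0 -linearB; apply/eqP.
  have /mkSubmodP // : repr (quot_proj (submod_span dlim_rel) x) - x \in lin_ker G.
  by apply: G0; rewrite -quotP quot_projK.
have hlin : linear h.
  move=> r u v; rewrite -(quot_projK u) -(quot_projK v) -linearP !hE.
  exact: linearP.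
exists (HB.pack_for {linear dlim -> L} h
  (GRing.isLinear.Build R dlim L *:%R h hlin)) => k x.
by rewrite /= hE Ggen.
Qed.

End DirectLimit.

Section LocalCohomology.
Variable R : comNzRingType.
Implicit Types (I J a : submodClosed R^o) (M X : lmodType R).

Definition ideal_mul I J : submodClosed R^o :=
  submod_span [set z : R^o | exists x y : R, [/\ x \in I, y \in J & z = x * y]].

Definition ideal_exp a k : submodClosed R^o := iter k (ideal_mul a) (submod_span setT).

Definition ideal_smul I M : submodClosed M :=
  submod_span [set z : M | exists (r : R) (x : M), r \in I /\ z = r *: x].

Lemma ideal_mul_subr I J : {subset ideal_mul I J <= J}.
Proof.
by apply: span_sub => _ [x [y [_ yJ ->]]]; change (x *: (y : R^o) \in J); exact: rpredZ.
Qed.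

Fact ideal_smul_exp_subproof a M k :
  {in ideal_smul (ideal_exp a k.+1) M, forall x,
     idfun x \in ideal_smul (ideal_exp a k) M}.
Proof.
apply: span_sub => _ [r [x [ra ->]]]; apply: sub_span; exists r, x; split => //.
exact: ideal_mul_subr ra.
Qed.

Definition adic_proj a M k :
    {linear quot_type (ideal_smul (ideal_exp a k.+1) M) ->
            quot_type (ideal_smul (ideal_exp a k) M)} :=
  quot_map (f := idfun) (@ideal_smul_exp_subproof a M k).

Definition gen_local_cohomology a i M X : lmodType R :=
  dlim (fun k => Ext_map X i (adic_proj a M k)).

Definition local_cohomology a i X : lmodType R :=
  gen_local_cohomology a i R^o X.

End LocalCohomology.

Section Rings.
Variable R : comNzRingType.
Implicit Types (I : submodClosed R^o) (m J : idealr R) (M : lmodType R).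

Definition fin_gen M : Prop := exists s : seq M, forall x, x \in submod_span [set` s].

Definition noetherian : Prop :=
  forall I, exists s : seq R^o, I =i submod_span [set` s].

Definition maximal_ideal m : Prop :=
  forall J, {subset m <= J} -> {subset J <= m}.

Definition local_ring m : Prop :=
  maximal_ideal m /\ forall J, maximal_ideal J -> J =i m.

Definition prime_chain (d : nat) (p : nat -> prime_idealr R) : Prop :=
  forall i, (i < d)%N -> [set` p i] `<` [set` p i.+1].

Definition krull_dim (n : nat) : Prop :=
  (exists p, prime_chain n p) /\
  forall d p, prime_chain d p -> (d <= n)%N.

Definition Ass M : set (set R) :=
  [set P | exists (p : prime_idealr R) (x : M),
     P = [set` p] /\ P = [set r | r *: x = 0]].

End Rings.

(* Main.v *)
Require Import Defs.
From HB Require Import structures.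
From mathcomp Require Import all_boot all_algebra ring_quotient.
From mathcomp Require Import boolp classical_sets cardinality.
From mathcomp Require Import freeg.
(* Once more, for [sub_span] to be the one on submodules. *)
Require Import Defs.

Set Implicit Arguments.
Unset Strict Implicit.
Unset Printing Implicit Defensive.

Import GRing.Theory.
Local Open Scope ring_scope.

(** The module H^i_a(M, X) has finite support, so finitely many associated
primes.  Fix a prime P other than m; its height is at most n - 1.

By prime avoidance ([exists_parameters]) one chooses n - 1 elements y of a such
that every prime of height less than n - 1 containing y contains a.  If P
contains a, then all primes below P that contain y contain a, so y and a
generate ideals with the same radical at P; hence the local cohomology of X at P
is that of the Cech complex of y ([cech]).  It vanishes above degree n - 1.  In
degree n - 1 it is the cokernel of N -> N_z, where z is the head of y and N is
the cohomology of degree n - 2 for the other elements; if it does not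
vanish at P then N has a prime Q below P and not containing z in its support.
By induction Q is one of finitely many primes, of height at least n - 2, and P
has to be minimal over Q + (z) because there is no room for another prime
between them.  So P belongs to a finite set [exc y], which does not even depend
on X: this is [cech_top].

Outside m and [exc y], then, the cohomology of the Cech complex vanishes at P in
degrees at least n - 1.  In lower degrees it vanishes by the hypothesis: where
the complex is exact below degree s, dimension shifting identifies the
cohomology of degree s, all of which is a-torsion, with a submodule of a module
whose H^0_a is H^s_a(X) ([exact_tors_lim]).  At P the Cech complex is therefore
a finite exact coresolution of X by modules on which some element of y acts
bijectively.  Such an element is nilpotent on D = M / a^k M, so these modules
have no Ext from D, and neither has X at P ([ext_tors_coresolution]).  Hence
H^i_a(M, X) vanishes at P ([gen_local_cohomology_tors]).  If P does not contain
a, it vanishes at P because it is a-torsion.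

Vanishing at P is expressed without localizing: every element is killed by some
element outside P ([tors]).  Ext is handled through cochains on a resolution,
with the long exact sequence in the second variable only; the two facts on the
first variable, that Ext from a finitely generated module preserves torsion and
that the annihilator of D kills Ext from D, both come from a factorization of
scalar multiplications along the resolution ([cobound_factor]). *)

(** * Linear maps and free modules *)

Section LinearMapConstructions.
Variable R : comNzRingType.
Implicit Types U V W : lmodType R.

Definition mk_linear V W (f : V -> W) (fl : linear f) : {linear V -> W} :=
  HB.pack_for {linear V -> W} f (GRing.isLinear.Build R V W *:%R f fl).

Lemma lin_factor U V W (q : {linear V -> W}) (g : {linear V -> U}) :
  (forall w, exists v, q v = w) -> (forall v, q v = 0 -> g v = 0) ->
  exists h : {linear W -> U}, forall v, h (q v) = g v.
Proof.
move=> /choice[c qc] qg.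
have gc v : g (c (q v)) = g v.
  by apply/eqP; rewrite -subr_eq0 -linearB qg// linearB/= qc subrr.
have hl : linear (g \o c).
  by move=> r x y; rewrite /= -[RHS]linearP -[in RHS]gc linearP/= !qc.
by exists (mk_linear hl) => v; exact: gc.
Qed.

Lemma lin_corestr V W (S : submodClosed W) (f : {linear V -> W}) :
  (forall v, f v \in S) ->
  exists g : {linear V -> submod_type S}, forall v, \val (g v) = f v.
Proof.
move=> fS; pose g v : submod_type S := Sub (f v) (fS v).
have gl : linear g by move=> r x y; apply: val_inj; rewrite /= !linearP.
by exists (mk_linear gl).
Qed.

Lemma free_lift (K : choiceType) V W (q : {linear V -> W})
    (g : {linear free_mod R K -> W}) :
  (forall k, exists v, q v = g << k >>) ->
  exists h : {linear free_mod R K -> V}, forall x, q (h x) = g x.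
Proof.
move=> /choice[c qc]; pose h : {linear free_mod R K -> V} := fglift c.
exists h; apply: (free_ext (f := q \o h)) => k /=.
by rewrite -qc; congr (q _); rewrite /h /= liftU scale1r.
Qed.

Lemma in_lin_ker V U (f : {linear V -> U}) x : f x = 0 -> x \in lin_ker f.
Proof. by move=> fx; apply/mkSubmodP. Qed.

Lemma lin_ker_val V U (f : {linear V -> U}) (x : submod_type (lin_ker f)) :
  f (\val x) = 0.
Proof. exact: (mkSubmodP _ _ _ _ (valP x)). Qed.

End LinearMapConstructions.

(** * Ext through cochains *)

Definition projective (R : comNzRingType) (P : lmodType R) : Prop :=
  forall (V W : lmodType R) (q : {linear V -> W}) (g : {linear P -> W}),
    (forall x, exists v, q v = g x) ->
    exists h : {linear P -> V}, forall x, q (h x) = g x.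

(** A projective resolution is abstracted to this, because the iterated syzygies
of the standard one make conversion costly. *)
Record proj_complex (R : comNzRingType) := ProjComplex {
  pobj :> nat -> lmodType R;
  pdiff : forall j, {linear pobj j.+1 -> pobj j};
  pdiffK : forall j x, pdiff j (pdiff j.+1 x) = 0;
  pobj_proj : forall j, projective (pobj j) }.

Section Cochains.
Variable R : comNzRingType.
Implicit Types (D : proj_complex R) (V W X : lmodType R).

Definition cocycle j D X (g : D j -> X) : Prop :=
  forall x : D j.+1, g (pdiff _ _ x) = 0.

Definition cobound j D X : (D j -> X) -> Prop :=
  match j return (D j -> X) -> Prop with
  | 0 => fun g => forall x, g x = 0
  | i.+1 => fun g =>
      exists h : {linear D i -> X}, forall x, g x = h (pdiff _ _ x)
  end.

Lemma cobound_comp j D V W (q : {linear V -> W}) (g : D j -> V) :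
  cobound g -> cobound (fun x => q (g x)).
Proof.
case: j g => [|j] g /=; first by move=> g0 x; rewrite g0 linear0.
by move=> [h gh]; exists (q \o h) => x; rewrite gh.
Qed.

(** The cochain that bounds the image in the quotient lifts, by projectivity;
subtracting the coboundary of the lift does not change the differential. *)
Lemma cobound_lift j D V W (q : {linear V -> W}) (h : {linear D j -> V}) :
  (forall w, exists v, q v = w) -> cobound (fun x => q (h x)) ->
  exists c : {linear D j -> V},
    (forall x, q (c x) = 0) /\ (forall x, c (pdiff _ _ x) = h (pdiff _ _ x)).
Proof.
move=> qs; case: j h => [|j] h /=; first by move=> qh; exists h.
move=> [w qh]; have [w' qw] := pobj_proj (q := q) (g := w) (fun=> qs _).
exists (h \- (w' \o pdiff D j)); split=> x /=.
  by rewrite linearB/= qw qh subrr.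
by rewrite pdiffK linear0 subr0.
Qed.

End Cochains.

(** [T] is a multiplicative set; the modules in which every element is killed
by some element of [T] are those with zero localization at [T], and they form
a Serre class, up to which exactness and vanishing are understood below. *)
Section Torsion.
Variables (R : comNzRingType) (T : set R).
Implicit Types (D : proj_complex R) (U V W X Y C : lmodType R).

Definition tors Y : Prop := forall y : Y, exists s, T s /\ s *: y = 0.

Definition ext_tors j D X : Prop := forall g : {linear D j -> X},
  cocycle g -> exists s, T s /\ cobound (fun x => s *: g x).

Hypothesis (TM : forall s t, T s -> T t -> T (s * t)).

Section Exact.
Variables (Y C W : lmodType R) (i : {linear Y -> C}) (q : {linear C -> W}).
Hypotheses (qs : forall w, exists c, q c = w).
Hypotheses (qi : forall y, q (i y) = 0).
Hypotheses (iq : forall c, q c = 0 -> exists y, i y = c).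

(** The differential of [v] is a cocycle with values in the kernel of [i]; up to
[T] it bounds a cochain [u] of the kernel, and s v - u is a cocycle with the
same image as s v. *)
Lemma ext_tors_corr j D (v : {linear D j -> Y}) :
  ext_tors j.+1 D (submod_type (lin_ker i)) ->
  (forall x, i (v (pdiff _ _ x)) = 0) ->
  exists (s : R) (u : {linear D j -> Y}), [/\ T s,
    forall x, i (u x) = 0 & forall x, s *: v (pdiff _ _ x) = u (pdiff _ _ x)].
Proof.
move=> Ek iv.
have [v' v'E] := lin_corestr (f := v \o pdiff D j)
  (fun x => in_lin_ker (iv x)).
have [s [Ts [h hE]]] : exists s, T s /\ cobound (fun x => s *: v' x).
  by apply: Ek => x; apply: val_inj; rewrite v'E /= pdiffK !linear0.
exists s, (\val \o h); split => // x; first exact: lin_ker_val.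
by have := congr1 \val (hE x); rewrite linearZ/= v'E.
Qed.

(** Exactness of Ext^(j-1)(W) -> Ext^j(im i) -> Ext^j(C), together with
Ext^j(ker i) -> Ext^j(Y) -> Ext^j(im i). *)
Lemma ext_tors_sub D :
  (forall j, ext_tors j D (submod_type (lin_ker i))) ->
  (forall j, ext_tors j D C) -> (forall j, ext_tors j D W) ->
  forall j, ext_tors j D Y.
Proof.
move=> Ek EC EW j g cg.
have [|s [Ts sg]] := EC j (i \o g); first by move=> x; rewrite /= cg linear0.
case: j g cg sg => [|j] g cg /=.
  move=> sg; have sgk x : (s \*: g) x \in lin_ker i.
    by apply: in_lin_ker; rewrite /= linearZ; exact: sg.
  have [g' g'E] := lin_corestr sgk.
  have [|t [Tt tg]] := Ek 0 g'.
    by move=> x; apply: val_inj; rewrite g'E /= cg scaler0.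
  exists (t * s); split; first exact: TM.
  by move=> x; have := congr1 \val (tg x); rewrite linearZ/= g'E/= scalerA.
move=> [h hE].
have [|t [Tt tq]] := EW j (q \o h).
  by move=> x; rewrite /= -hE /= linearZ/= qi scaler0.
have [|c [qc cE]] := cobound_lift (h := t \*: h) qs.
  have -> // : (fun x => q ((t \*: h) x)) = (fun x => t *: (q \o h) x).
  by apply: funext => x; rewrite /= linearZ.
have [v vE] := pobj_proj (q := i) (g := c) (fun x => iq (qc x)).
pose r := ((t * s) \*: g) \- (v \o pdiff D j).
have ir x : i (r x) = 0.
  by rewrite /r /= linearB linearZ/= vE cE /= -hE scalerA subrr.
have [r' r'E] := lin_corestr (fun x => in_lin_ker (ir x)).
have [|u [Tu [w wE]]] := Ek j.+1 r'.
  by move=> x; apply: val_inj; rewrite r'E /r /= cg pdiffK !linear0 addr0.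
exists (u * (t * s)); split; first by do !apply: TM.
exists ((u \*: v) \+ (\val \o w)) => x.
have := congr1 \val (wE x); rewrite linearZ/= r'E /r /= => <-.
by rewrite -scalerDr addrC subrK scalerA.
Qed.

Variables (D : nat -> proj_complex R).
Variable pi : forall k j, {linear D k.+1 j -> D k j}.
Hypothesis pi_diff : forall k j x,
  pi k j (pdiff _ _ x) = pdiff _ _ (pi k j.+1 x).

Fixpoint sys_map j d k : {linear D (d + k)%N j -> D k j} :=
  if d is d'.+1 return {linear D (d + k)%N j -> D k j}
  then sys_map j d' k \o pi (d' + k)%N j else idfun.

Lemma sys_map_diff j d k x :
  sys_map j d k (pdiff _ _ x) = pdiff _ _ (sys_map j.+1 d k x).
Proof. by elim: d x => [//|d IHd] x /=; rewrite pi_diff IHd. Qed.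

(** [tors] of the direct limit of the modules Ext^j(D k, X), in terms of
representatives. *)
Definition lim_ext_tors j X : Prop := forall k (g : {linear D k j -> X}),
  cocycle g ->
  exists s d, T s /\ cobound (fun x => s *: g (sys_map j d k x)).

(** The connecting map Ext^j(D k, W) -> Ext^(j+1)(D k, Y) has torsion kernel, as
Ext^j(D k, C) is torsion, and is natural in k. *)
Lemma lim_ext_tors_quot j :
  (forall k, ext_tors j.+2 (D k) (submod_type (lin_ker i))) ->
  (forall k, ext_tors j (D k) C) ->
  lim_ext_tors j.+1 Y -> lim_ext_tors j W.
Proof.
move=> Ek EC HY k z cz.
have [z' z'E] := pobj_proj (q := q) (g := z) (fun=> qs _).
have qz' x : q (z' (pdiff _ _ x)) = 0 by rewrite z'E cz.
have [v vE] := pobj_proj (q := i) (g := z' \o pdiff (D k) j)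
  (fun x => iq (qz' x)).
have [|s [u [Ts iu uE]]] := ext_tors_corr (v := v) (Ek k).
  by move=> x; rewrite vE /= pdiffK linear0.
have [|t [d [Tt [w wE]]]] := HY k ((s \*: v) \- u).
  by move=> x; rewrite /= uE subrr.
have [|r [Tr rE]] := EC (d + k)%N
    (((t * s) \*: (z' \o sys_map j d k)) \- (i \o w)).
  move=> x; rewrite /= -wE /= linearZ/= linearB/= iu subr0.
  rewrite [i (_ *: _)]linearZ/= vE/=.
  by rewrite sys_map_diff scalerA subrr.
exists (r * (t * s)), d; split; first by do !apply: TM.
have := cobound_comp q rE; congr (cobound _); apply: funext => x.
by rewrite linearZ/= linearB linearZ/= z'E qi subr0 scalerA.
Qed.

End Exact.
End Torsion.

(** * Multiplication by a scalar on a resolution *)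

Section Resolution.
Variable R : comNzRingType.
Implicit Types U V W L F Y : lmodType R.

Lemma lin_corestr_inj U V W (i : {linear U -> W}) (f : {linear V -> W}) :
  injective i -> (forall v, exists u, i u = f v) ->
  exists g : {linear V -> U}, forall v, i (g v) = f v.
Proof.
move=> inj_i /choice[g gE].
have gl : linear g by move=> r x y; apply: inj_i; rewrite gE !linearP/= !gE.
by exists (mk_linear gl).
Qed.

(** A class of modules with projective resolutions inside the class. *)
Definition has_covers (cls : lmodType R -> Prop) : Prop :=
  forall L, cls L -> exists F (q : {linear F -> L}),
  [/\ projective F, forall l, exists f, q f = l & cls (submod_type (lin_ker q))].

(* The syzygies [Z] of a projective resolution [P]. *)
Variables (Z P : nat -> lmodType R).
Variables (e : forall j, {linear P j -> Z j}).
Variables (io : forall j, {linear Z j.+1 -> P j}).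
Hypotheses (e_surj : forall j z, exists x, e j x = z).
Hypotheses (io_inj : forall j, injective (io j)).
Hypotheses (eio : forall j z, e j (io j z) = 0).
Hypotheses (ioe : forall j x, e j x = 0 -> exists z, io j z = x).
Hypotheses (projP : forall j, projective (P j)).

Let dK j x : (io j \o e j.+1) ((io j.+1 \o e j.+2) x) = 0.
Proof. by rewrite /= eio linear0. Qed.

Definition splice : proj_complex R := ProjComplex dK projP.

Variable cls : lmodType R -> Prop.
Hypothesis cls_cover : has_covers cls.

(** If multiplication by [r] on a module factors, up to a map through a
projective module, through a module of the class, then so does its
restriction to the next syzygy: lift the factorization to the projective covers
of both modules.  The error [th0] lands in the kernel of the cover, and it is
defined on all of P j. *)
Lemma syz_factor_step r j L (sg : {linear L -> Z j}) (ta : {linear Z j -> L})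
    (Th : {linear Z j -> P j}) :
  cls L -> (forall z, r *: z = sg (ta z) + e j (Th z)) ->
  exists L' (sg' : {linear L' -> Z j.+1}) (ta' : {linear Z j.+1 -> L'})
      (th : {linear P j -> Z j.+1}),
    cls L' /\ (forall z, r *: z = sg' (ta' z) + th (io j z)).
Proof.
move=> clsL rE; have [F [q [projF q_surj clsK]]] := cls_cover clsL.
have [s sE] := projF _ _ (e j) (sg \o q) (fun x => @e_surj j _).
have [t tE] := @projP j _ _ q (ta \o e j) (fun x => q_surj _).
pose th0 := ((r \*: idfun) \- (s \o t)) \- (Th \o e j).
have eth0 x : e j (th0 x) = 0.
  rewrite /th0 /= !linearB linearZ/= sE /= tE /= rE.
  by rewrite addrAC addrK subrr.
have [th thE] := @projP j _ _ (io j) th0 (fun x => ioe (eth0 x)).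
have [ta' ta'E] : exists ta' : {linear Z j.+1 -> submod_type (lin_ker q)},
    forall z, \val (ta' z) = t (io j z).
  apply: (lin_corestr (f := t \o io j)) => z.
  by apply: in_lin_ker; rewrite /= tE /= eio linear0.
have [|sg' sg'E] := lin_corestr_inj (i := io j)
    (f := s \o (\val : submod_type (lin_ker q) -> F)) (@io_inj j).
  by move=> k; apply: ioe; rewrite /= sE /= lin_ker_val linear0.
exists _, sg', ta', th; split => // z; apply: (@io_inj j).
rewrite linearD/= thE sg'E /= ta'E /th0 /= eio linear0 subr0 linearZ/=.
by rewrite addrC subrK.
Qed.

Lemma syz_factor r :
  (exists L (sg : {linear L -> Z 0}) (ta : {linear Z 0 -> L}),
    cls L /\ (forall z, r *: z = sg (ta z))) ->
  forall j, exists L (sg : {linear L -> Z j.+1}) (ta : {linear Z j.+1 -> L})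
      (th : {linear P j -> Z j.+1}),
    cls L /\ (forall z, r *: z = sg (ta z) + th (io j z)).
Proof.
move=> [L [sg [ta [clsL rE]]]]; elim=> [|j [L' [sg' [ta' [th [clsL' rE']]]]]].
  apply: (syz_factor_step (Th := \0)) clsL _ => z.
  by rewrite /= linear0 addr0.
have [Th ThE] := @projP j _ _ (e j.+1) th (fun x => @e_surj _ _).
apply: (syz_factor_step (Th := Th \o io j)) clsL' _ => z.
by rewrite /= ThE.
Qed.

(** A cocycle is a map [gb] on a syzygy, and a coboundary if that map extends to
the projective module around; so, up to a coboundary, r gb factors through a
module of the class. *)
Lemma cobound_factor (T : set R) r Y :
  (exists L (sg : {linear L -> Z 0}) (ta : {linear Z 0 -> L}),
    cls L /\ (forall z, r *: z = sg (ta z))) ->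
  (forall L (f : {linear L -> Y}), cls L ->
     exists s, T s /\ forall l, s *: f l = 0) ->
  forall j (g : {linear splice j -> Y}), cocycle g ->
  exists s, T s /\ cobound (fun x : splice j => (s * r) *: g x).
Proof.
move=> rE clsY j g cg.
have [gb gbE] : exists gb : {linear Z j -> Y}, forall x, gb (e j x) = g x.
  apply: lin_factor => [z|x ex]; first exact: e_surj.
  have [z <-] := ioe ex; have [w <-] := e_surj z; exact: cg.
case: j g cg gb gbE => [|j] g cg gb gbE.
  have [L [sg [ta [clsL {}rE]]]] := rE.
  have [s [Ts sE]] := clsY _ (gb \o sg) clsL.
  exists s; split => // x; rewrite -scalerA -gbE -[r *: gb _]linearZ rE.
  exact: sE.
have [L [sg [ta [th [clsL rE']]]]] := syz_factor rE j.
have [s [Ts sE]] := clsY _ (gb \o sg) clsL.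
exists s; split => //; exists (s \*: (gb \o th)) => x.
rewrite -scalerA -gbE -[r *: gb _]linearZ rE' linearD scalerDr.
by have /= -> := sE (ta (e j.+1 x)); rewrite add0r.
Qed.

End Resolution.

(** * Noetherian rings and finitely generated modules *)

Section FinGen.
Variable R : comNzRingType.
Implicit Types F V W L : lmodType R.
Local Open Scope classical_set_scope.

Lemma span_seq V (s : seq V) (S : submodClosed V) :
  (forall x, x \in s -> x \in S) -> {subset submod_span [set` s] <= S}.
Proof. by move=> sS; apply: span_sub => x; exact: sS. Qed.

Lemma mem_span V (s : seq V) x : x \in s -> x \in submod_span [set` s].
Proof. by move=> xs; apply: sub_span. Qed.

Lemma submodB V (S : submodClosed V) x y : x \in S -> y \in S -> x - y \in S.
Proof. by move=> Sx Sy; rewrite -scaleN1r rpredD// rpredZ. Qed.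

Lemma span_consP V (a : V) (s : seq V) x : x \in submod_span [set` a :: s] ->
  exists (r : R) u, u \in submod_span [set` s] /\ x = r *: a + u.
Proof.
pose Q := [set x : V | exists (r : R) u,
  u \in submod_span [set` s] /\ x = r *: a + u].
have Q0 : Q 0 by exists 0, 0; rewrite rpred0 scale0r addr0.
have QD y z : Q y -> Q z -> Q (y + z).
  move=> [r [u [su ->]]] [r' [u' [su' ->]]]; exists (r + r'), (u + u').
  by rewrite rpredD// scalerDl addrACA.
have QZ r y : Q y -> Q (r *: y).
  move=> [r' [u [su ->]]]; exists (r * r'), (r *: u).
  by rewrite rpredZ// scalerDr scalerA.
suff sQ : {subset submod_span [set` a :: s] <= mkSubmod Q0 QD QZ}.
  by move=> /sQ/mkSubmodP.
apply: span_seq => y; rewrite inE => /predU1P[->|ys]; apply/mkSubmodP.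
  by exists 1, 0; rewrite rpred0 scale1r addr0.
by exists 0, y; rewrite scale0r add0r; split => //; exact: mem_span.
Qed.

(** One generator [a] at a time: [S] is generated by its intersection [J] with
the span of the others and by finitely many elements whose coefficients on [a]
generate the ideal [I] of all such coefficients. *)
Lemma noetherian_sub V (s : seq V) (S : submodClosed V) : noetherian R ->
  {subset S <= submod_span [set` s]} ->
  exists t : seq V, S =i submod_span [set` t].
Proof.
move=> noethR; elim: s S => [|a s IHs] S Ss.
  exists [::] => x; apply/idP/idP; first exact: Ss.
  by move: x; apply: span_seq => y; rewrite in_nil.
pose I := [set r : R^o | exists u,
  u \in submod_span [set` s] /\ r *: a + u \in S].
have I0 : I 0 by exists 0; rewrite rpred0 scale0r addr0 rpred0.
have ID r r' : I r -> I r' -> I (r + r').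
  move=> [u [su Su]] [u' [su' Su']]; exists (u + u').
  by split; [exact: rpredD|rewrite scalerDl addrACA; exact: rpredD].
have IZ (c : R) r : I r -> I (c *: r).
  move=> [u [su Su]]; exists (c *: u).
  by rewrite -scalerA -scalerDr; split; exact: rpredZ.
have [rs rsE] := noethR (mkSubmod I0 ID IZ).
have /choice[u uE] (r : R^o) : exists u, r \in rs ->
    u \in submod_span [set` s] /\ r *: a + u \in S.
  case: (boolP (r \in rs)) => [rrs|]; last by exists 0.
  have /mkSubmodP[v vP] : r \in mkSubmod I0 ID IZ by rewrite rsE; exact: mem_span.
  by exists v.
pose J := [set x | x \in S /\ x \in submod_span [set` s]].
have J0 : J 0 by split; rewrite rpred0.
have JD x y : J x -> J y -> J (x + y).
  by move=> [Sx sx] [Sy sy]; split; rewrite rpredD.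
have JZ c x : J x -> J (c *: x) by move=> [Sx sx]; split; rewrite rpredZ.
have [|t tE] := IHs (mkSubmod J0 JD JZ); first by move=> x /mkSubmodP[].
pose t' := [seq r *: a + u r | r <- rs] ++ t.
have t'S : {subset submod_span [set` t'] <= S}.
  apply: span_seq => x; rewrite mem_cat => /orP[/mapP[r rrs ->]|xt].
    by have [] := uE r rrs.
  have : x \in submod_span [set` t] by exact: mem_span.
  by rewrite -tE => /mkSubmodP[].
have tt' : {subset submod_span [set` t] <= submod_span [set` t']}.
  by apply: span_seq => x xt; apply: mem_span; rewrite mem_cat xt orbT.
exists t' => x; apply/idP/idP; last exact: t'S.
move=> Sx; have [r [w [sw xE]]] := span_consP (Ss _ Sx).
pose K := [set r : R^o | exists y v,
  [/\ y \in submod_span [set` t'], v \in submod_span [set` s] & y = r *: a + v]].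
have K0 : K 0 by exists 0, 0; rewrite !rpred0 scale0r addr0.
have KD c d : K c -> K d -> K (c + d).
  move=> [y [v [ty sv yE]]] [y' [v' [ty' sv' yE']]]; exists (y + y'), (v + v').
  by split; [exact: rpredD|exact: rpredD|rewrite yE yE' scalerDl addrACA].
have KZ (c : R) d : K d -> K (c *: d).
  move=> [y [v [ty sv yE]]]; exists (c *: y), (c *: v).
  by split; [exact: rpredZ|exact: rpredZ|rewrite yE scalerDr scalerA].
have rsK : {subset submod_span [set` rs] <= mkSubmod K0 KD KZ}.
  apply: span_seq => c crs; apply/mkSubmodP; have [su _] := uE c crs.
  exists (c *: a + u c), (u c); split => //; apply: mem_span.
  by rewrite mem_cat (map_f (fun r : R^o => r *: a + u r) crs).
have /rsK/mkSubmodP[y [v [ty sv yE]]] : (r : R^o) \in submod_span [set` rs].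
  by rewrite -rsE; apply/mkSubmodP; exists w; rewrite -xE.
rewrite -(subrK y x) rpredD//; apply: tt'; rewrite -tE; apply/mkSubmodP.
split; first by apply: submodB; last exact: t'S.
by rewrite xE yE opprD addrACA subrr add0r; exact: submodB.
Qed.

Lemma fin_gen_submod V (S : submodClosed V) :
  noetherian R -> fin_gen V -> fin_gen (submod_type S).
Proof.
move=> noethR [s sV]; have [//|t tE] := @noetherian_sub V s S noethR.
have [t' t't] : exists t' : seq (submod_type S), map \val t' = t.
  have: {subset t <= S} by move=> x xt; rewrite tE; exact: mem_span.
  elim: (t) => [|x l IHl] lS; first by exists [::].
  have [|l' <-] := IHl; first by move=> z zl; rewrite lS// inE zl orbT.
  by exists ((Sub x (lS x (mem_head _ _)) : submod_type S) :: l').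
pose Q := [set v | exists y : submod_type S,
  y \in submod_span [set` t'] /\ \val y = v].
have Q0 : Q 0 by exists 0; rewrite rpred0.
have QD v w : Q v -> Q w -> Q (v + w).
  by move=> [y [ty <-]] [z [tz <-]]; exists (y + z); rewrite rpredD.
have QZ c v : Q v -> Q (c *: v).
  by move=> [y [ty <-]]; exists (c *: y); rewrite rpredZ.
exists t' => x.
suff /mkSubmodP[y [ty /val_inj <-//]] : \val x \in mkSubmod Q0 QD QZ.
have: \val x \in submod_span [set` t] by rewrite -tE; exact: (valP x).
apply: span_seq => z; rewrite -t't => /mapP[y yt ->].
by apply/mkSubmodP; exists y; split => //; exact: mem_span.
Qed.

Lemma fin_gen_im V W (f : {linear V -> W}) :
  (forall w, exists v, f v = w) -> fin_gen V -> fin_gen W.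
Proof.
move=> fs [s sV]; exists (map f s) => w; have [v <-] := fs w.
have /mkSubmodP// : v \in submod_preim f (submod_span [set` map f s]).
have := sV v; apply: span_seq => x xs; apply/mkSubmodP.
by apply: mem_span; exact: map_f.
Qed.

Lemma free_mod_projective (K : choiceType) : projective (free_mod R K).
Proof. by move=> V W q g gq; apply: free_lift. Qed.

Lemma fin_gen_cover : noetherian R -> has_covers (@fin_gen R).
Proof.
move=> noethR L [s sL]; pose F := free_mod R 'I_(size s).
pose q : {linear F -> L} := fglift (fun i => tnth (in_tuple s) i).
exists F, q; split; first exact: free_mod_projective.
  move=> l; suff /mkSubmodP[x _ <-] : l \in lin_im q by exists x.
  have := sL l; apply: span_seq => x xs; apply/mkSubmodP.
  have /tnthP[i xE] : x \in in_tuple s by [].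
  by exists << i >> => //; rewrite /q /= liftU scale1r -xE.
apply: fin_gen_submod => //; exists [seq << i >> | i <- enum 'I_(size s)] => x.
rewrite -(freeg_sumE x); apply: rpred_sum => i _.
have -> : << coeff i x *g i >> = coeff i x *: (<< i >> : F).
  by apply/eqP/freeg_eqP => l; rewrite coeffZ !coeffU mul1r.
by apply: rpredZ; apply: mem_span; apply/mapP; exists i; rewrite ?mem_enum.
Qed.

End FinGen.

Local Open Scope classical_set_scope.

(** * The standard resolution *)

Section StandardResolution.
Variable R : comNzRingType.
Implicit Types D C Y L F : lmodType R.

Definition std_res D : proj_complex R.
Proof.
refine (@splice R (fun j => syz j D) (fun j => res j D)
  (fun j => @free_aug R (syz j D)) (fun j => \val) _ _).
- by move=> j z; exact: lin_ker_val.
- by move=> j; exact: free_mod_projective.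
Defined.

Lemma std_res_cobound_factor (cls : lmodType R -> Prop) (T : set R) r D Y :
  has_covers cls ->
  (exists L (sg : {linear L -> D}) (ta : {linear D -> L}),
    cls L /\ (forall z, r *: z = sg (ta z))) ->
  (forall L (f : {linear L -> Y}), cls L ->
     exists s, T s /\ forall l, s *: f l = 0) ->
  forall j (g : {linear std_res D j -> Y}), cocycle g ->
  exists s, T s /\ cobound (fun x : std_res D j => (s * r) *: g x).
Proof.
move=> cover; have surj j z : exists x : res j D, free_aug x = z.
  exact: free_aug_surj.
have ker j (x : res j D) : free_aug x = 0 -> exists z : syz j.+1 D, \val z = x.
  by move=> ex; exists (Sub x (in_lin_ker ex)).
exact: (@cobound_factor R (fun j => syz j D) (fun j => res j D)
  (fun j => @free_aug R (syz j D)) (fun j => \val) surj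
  (fun j => val_inj) _ ker _ _ cover T r Y).
Qed.

End StandardResolution.

Section ExtVanishing.
Variable R : comNzRingType.
Implicit Types C D L Y : lmodType R.

(** Take the class of finitely generated modules, through one of which, [D],
multiplication by 1 factors: up to coboundaries, a cocycle is determined by
finitely many values, and one element of [T] kills them. *)
Lemma ext_tors_fin_gen (T : set R) D Y j :
  T 1 -> (forall s t, T s -> T t -> T (s * t)) ->
  noetherian R -> fin_gen D -> tors T Y -> ext_tors T j (std_res D) Y.
Proof.
move=> T1 TM noethR fgD torsY g cg.
have [|||s [Ts sg]] :=
    @std_res_cobound_factor R (@fin_gen R) T 1 D Y _ _ _ j g cg.
- exact: fin_gen_cover.
- by exists D, idfun, idfun; split => // z; rewrite scale1r.
- move=> L f [l lL].
  have [s [Ts sl]] : exists s, T s /\ forall x, x \in l -> s *: f x = 0.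
    elim: (l) => [|x l' [s [Ts sl']]]; first by exists 1.
    have [t [Tt tx]] := torsY (f x); exists (t * s); split; first exact: TM.
    move=> z; rewrite inE => /predU1P[->|/sl' sz].
      by rewrite mulrC -scalerA tx scaler0.
    by rewrite -scalerA sz scaler0.
  exists s; split => // x.
  suff: x \in lin_ker (s \*: f) by move=> /mkSubmodP.
  by have := lL x; apply: span_seq => z /sl sz; apply: in_lin_ker.
exists s; split => //; move: sg; congr (cobound _).
by apply: funext => x; rewrite mulr1.
Qed.

Definition acyclic (P : proj_complex R) C : Prop :=
  forall j (g : {linear P j -> C}), cocycle g -> cobound g.

Lemma acyclic_ext_tors (T : set R) P C j :
  T 1 -> acyclic P C -> ext_tors T j P C.
Proof.
move=> T1 acC g cg; exists 1; split => //.
by have := acC j g cg; congr (cobound _); apply: funext => x; rewrite scale1r.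
Qed.

(** Multiplication by [r] on [D] factors through the zero module, so take the
class of zero modules. *)
Lemma cobound_ann D Y r j (g : {linear std_res D j -> Y}) :
  (forall z : D, r *: z = 0) -> cocycle g -> cobound (fun x => r *: g x).
Proof.
move=> rD cg; pose cls L := forall x : L, x = 0.
have [|||s [s1]] := @std_res_cobound_factor R cls [set 1] r D Y _ _ _ j g cg.
- move=> L L0; exists L, idfun; split.
  + by move=> V W q f _; exists \0 => x; rewrite [x]L0 !linear0.
  + by move=> l; exists l.
  + by move=> x; apply: val_inj; rewrite [LHS]L0 [RHS]L0.
- exists 'rV[R]_0, \0, \0; split => [x|z]; first exact: thinmx0.
  by rewrite rD.
- move=> L f L0; exists 1; split => // l.
  by rewrite (L0 l) linear0 scaler0.
by rewrite {1}s1 mul1r.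
Qed.

Lemma ext_tors_ann (T : set R) D Y r j :
  T r -> (forall z : D, r *: z = 0) -> ext_tors T j (std_res D) Y.
Proof. by move=> Tr rD g cg; exists r; split => //; exact: cobound_ann. Qed.

(** On Ext^j(D, C), [r] acts both as zero, because it does on [D], and
bijectively, because it does on [C]. *)
Lemma acyclic_bij D C r :
  (forall z : D, r *: z = 0) ->
  (forall c : C, r *: c = 0 -> c = 0) -> (forall c : C, exists c', r *: c' = c) ->
  acyclic (std_res D) C.
Proof.
move=> rD rC0 rC j g cg.
have [h hE] : exists h : {linear C -> C}, forall c, h (r *: c) = c.
  by apply: (lin_factor (q := r \*: idfun) (g := idfun)).
have /(cobound_comp h) := cobound_ann rD cg; congr (cobound _).
by apply: funext => x; rewrite hE.
Qed.

End ExtVanishing.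

(** * Sequential direct limits *)

Section Limit.
Variables (R : comNzRingType) (E : nat -> lmodType R).
Variable phi : forall k, {linear E k -> E k.+1}.

Fixpoint trans d k : {linear E k -> E (d + k)%N} :=
  if d is d'.+1 return {linear E k -> E (d + k)%N}
  then phi (d' + k)%N \o trans d' k else idfun.

Definition stage_cast k N (x : E k) : E N :=
  if @eqP _ k N is ReflectT e then ecast n (E n) e x else 0.

(** All the transition maps at once, extended by zero, so that a formal sum of
elements of various stages has an image in each stage. *)
Fixpoint stage N k (x : E k) : E N :=
  if k == N then stage_cast N x
  else if N is N'.+1 return E N then phi N' (stage N' x) else 0.

Lemma stageE N k (x : E k) : stage N x = if k == N then stage_cast N x
  else if N is N'.+1 return E N then phi N' (stage N' x) else 0.
Proof. by case: N. Qed.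

Lemma stage_is_linear N k : linear (@stage N k).
Proof.
have cast_lin n : linear (@stage_cast k n).
  move=> r x y; rewrite /stage_cast; case: eqP => [e|_]; first by case: n / e.
  by rewrite scaler0 addr0.
elim: N => [|N IHN] r x y;
  rewrite (stageE _ x) (stageE _ y) stageE; case: ifP => _;
  try exact: cast_lin.
  by rewrite scaler0 addr0.
by rewrite IHN linearP.
Qed.

Lemma stage_id k (x : E k) : stage k x = x.
Proof.
have castx : stage_cast k x = x.
  by rewrite /stage_cast; case: eqP => [e|//]; rewrite (eq_axiomK e).
by rewrite stageE eqxx.
Qed.

Lemma stageS N k (x : E k) : (k <= N)%N -> stage N.+1 x = phi N (stage N x).
Proof. by move=> kN; rewrite stageE ltn_eqF. Qed.

Lemma stage_phi N k (x : E k) : (k < N)%N -> stage N (phi k x) = stage N x.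
Proof.
elim: N => [//|N IHN]; rewrite ltnS leq_eqVlt => /predU1P[<-|kN].
  by rewrite stage_id stageS// stage_id.
by rewrite stageS// IHN// stageS// ltnW.
Qed.

Lemma dlim_in_stage N k (x : E k) :
  (k <= N)%N -> dlim_in phi (stage N x) = dlim_in phi x.
Proof.
elim: N => [|N IHN]; first by case: k x => // x _; rewrite stage_id.
rewrite leq_eqVlt => /predU1P[<-|kN]; first by rewrite stage_id.
by rewrite stageS// dlim_in_phi IHN.
Qed.

Lemma dlim_surj (u : dlim phi) : exists k (x : E k), dlim_in phi x = u.
Proof.
rewrite -(quot_projK u); move: (repr u) => v.
pose Q := [set v : free_mod R {k : nat & E k} | exists k (x : E k),
  dlim_in phi x = quot_proj (submod_span (dlim_rel phi)) v].
have Q0 : Q 0 by exists 0%N, 0; rewrite !linear0.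
have QD w w' : Q w -> Q w' -> Q (w + w').
  move=> [n [x xv]] [m [y yw]].
  exists (maxn n m), (stage (maxn n m) x + stage (maxn n m) y).
  rewrite linearD [RHS]linearD /= -xv -yw.
  by rewrite !dlim_in_stage// (leq_maxl, leq_maxr).
have QZ r w : Q w -> Q (r *: w).
  move=> [n [x xv]]; exists n, (r *: x).
  by rewrite [LHS]linearZ [RHS]linearZ/= xv.
suff /mkSubmodP : v \in mkSubmod Q0 QD QZ by [].
rewrite -(freeg_sumE v); apply: rpred_sum => p _.
have -> : << coeff p v *g p >> =
    coeff p v *: (<< p >> : free_mod R {k : nat & E k}).
  by apply/eqP/freeg_eqP => l; rewrite coeffZ !coeffU mul1r.
by apply: rpredZ; apply/mkSubmodP; case: p => k x; exists k, x.
Qed.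

Lemma stage_trans d k (x : E k) : stage (d + k) x = trans d k x.
Proof.
elim: d => [|d IHd]; first exact: stage_id.
by rewrite [LHS]stageS ?leq_addl//= IHd.
Qed.

(** The relations defining the direct limit hold in all stages that are far
enough, so this is so of their consequences. *)
Lemma dlim_in_eq0 k (x : E k) : dlim_in phi x = 0 -> exists d, trans d k x = 0.
Proof.
pose G N : {linear free_mod R {k : nat & E k} -> E N} :=
  fglift (fun p : {k : nat & E k} => stage N (tagged p)).
have Ggen N n (y : E n) : G N (dlim_gen y) = stage N y.
  by rewrite [LHS]liftU scale1r.
pose Q := [set u : free_mod R {k : nat & E k} |
  exists N0, forall N, (N0 <= N)%N -> G N u = 0].
have Q0 : Q 0 by exists 0%N => N _; rewrite linear0.
have QD u v : Q u -> Q v -> Q (u + v).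
  move=> [n un] [m vm]; exists (maxn n m) => N; rewrite geq_max => /andP[nN mN].
  by rewrite linearD un// vm// addr0.
have QZ r u : Q u -> Q (r *: u).
  by move=> [n un]; exists n => N nN; rewrite linearZ/= un// scaler0.
have relQ : {subset submod_span (dlim_rel phi) <= mkSubmod Q0 QD QZ}.
  apply: span_sub => _ [[n [r [y [z ->]]]]|[n [y ->]]]; apply/mkSubmodP.
    exists 0%N => N _; rewrite linearB linearP !Ggen stage_is_linear.
    exact: subrr.
  exists n.+1 => N nN; rewrite linearB !Ggen stage_phi//.
  exact: subrr.
move=> /eqP; rewrite -[0](linear0 (quot_proj (submod_span (dlim_rel phi)))).
rewrite quotP subr0 => /relQ/mkSubmodP[N xN].
exists N; rewrite -stage_trans -Ggen; apply: xN; exact: leq_addr.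
Qed.

Lemma tors_dlim (T : set R) : (forall k, tors T (E k)) -> tors T (dlim phi).
Proof.
move=> tE u; have [k [x <-]] := dlim_surj u; have [s [Ts sx]] := tE k x.
exists s; split => //; have <- : dlim_in phi (s *: x) = s *: dlim_in phi x.
  exact: linearZ.
by rewrite sx linear0.
Qed.

End Limit.

(** * The modules Ext and their limits in terms of cochains *)

Section ExtCochains.
Variable R : comNzRingType.
Implicit Types D V X : lmodType R.

Lemma val_subZ V (S : submodClosed V) s (z : submod_type S) :
  \val (s *: z) = s *: \val z.
Proof. exact: linearZ. Qed.

Lemma quot_projZ V (S : submodClosed V) s z :
  quot_proj S (s *: z) = s *: quot_proj S z.
Proof. exact: linearZ. Qed.

Lemma cobound_ext (P : proj_complex R) j X (f g : P j -> X) :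
  f =1 g -> cobound f -> cobound g.
Proof. by move=> /funext ->. Qed.

Lemma Ext_class j D X (z : submod_type (cocycles X j D)) :
  cocycle (D := std_res D) (j := j) (\val (\val z)).
Proof.
move=> x; have /mkSubmodP z0 := valP z.
exact: (congr1 (fun f : Hom_mod (res j.+1 D) X => \val f x) z0).
Qed.

Lemma Hom_mod_linear V X (f : Hom_mod V X) : linear (\val f).
Proof. exact: (mkSubmodP _ _ _ _ (valP f)). Qed.

Definition Hom_fun V X (f : Hom_mod V X) : {linear V -> X} :=
  mk_linear (Hom_mod_linear f).

Lemma Hom_valZ V X s (f : Hom_mod V X) x : \val (s *: f) x = s *: \val f x.
Proof. by []. Qed.

Lemma fun_Hom V X (f : {linear V -> X}) : exists g : Hom_mod V X, \val g = f.
Proof.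
have fl : idfun \o f \in linear_funs V X.
  by apply/asboolP => r x y /=; rewrite linearP.
by exists (Sub (idfun \o f) fl).
Qed.

Lemma coboundariesP j D X (z : Hom_mod (res j D) X) :
  z \in coboundaries X j D <-> cobound (D := std_res D) (j := j) (\val z).
Proof.
case: j z => [|j] z; split.
- move=> zB x.
  have sub0 : set0 `<=` [set` lin_ker (@idfun (Hom_mod (res 0 D) X))] by [].
  by have /mkSubmodP/= -> := span_sub sub0 zB.
- move=> z0; have -> : z = 0 by apply: val_inj; apply: funext.
  exact: rpred0.
- by move=> /mkSubmodP[y _ <-]; exists (Hom_fun y).
- move=> [h hE]; apply/mkSubmodP; have [y yE] := fun_Hom h.
  by exists y => //; apply: val_inj; apply: funext => x; rewrite hE /= yE.
Qed.

Lemma Ext_eq0 j D X (z : submod_type (cocycles X j D)) :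
  quot_proj (coboundaries_in X j D) z = 0 <->
  cobound (D := std_res D) (j := j) (\val (\val z)).
Proof.
rewrite -coboundariesP; split.
  move=> /eqP; rewrite -[0](linear0 (quot_proj (coboundaries_in X j D))).
  by rewrite quotP subr0 => /mkSubmodP.
move=> zB; apply/eqP; rewrite -[0](linear0 (quot_proj (coboundaries_in X j D))).
by rewrite quotP subr0; apply/mkSubmodP.
Qed.

Lemma tors_Ext (T : set R) j D X :
  ext_tors T j (std_res D) X -> tors T (Ext X j D).
Proof.
move=> tX u; rewrite -(quot_projK u); move: (repr u) => z.
have [s [Ts sz]] := tX (Hom_fun (\val z)) (Ext_class z).
exists s; split => //; rewrite -quot_projZ; apply/Ext_eq0.
apply: cobound_ext sz => x; rewrite val_subZ.
exact: Hom_valZ.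
Qed.

Section System.
Variables (D : nat -> lmodType R) (pi : forall k, {linear D k.+1 -> D k}).

Definition std_sys k j : {linear std_res (D k.+1) j -> std_res (D k) j} :=
  res_map j (pi k).

Lemma std_sys_diff k j x :
  std_sys k j (pdiff _ _ x) = pdiff _ _ (std_sys k j.+1 x).
Proof. exact: res_map_diff. Qed.

Lemma trans_Ext X j d k (z : submod_type (cocycles X j (D k))) :
  exists z' : submod_type (cocycles X j (D (d + k)%N)),
    trans (fun k => Ext_map X j (pi k)) d k
      (quot_proj (coboundaries_in X j (D k)) z)
      = quot_proj (coboundaries_in X j (D (d + k)%N)) z' /\
    forall x, \val (\val z') x =
      \val (\val z) (sys_map (D := fun k => std_res (D k)) std_sys j d k x).
Proof.
elim: d => [|d [z' [tE z'E]]]; first by exists z.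
exists (cocycle_map X j (pi (d + k)) z'); split.
  by rewrite /= tE; exact: quot_map_proj.
by move=> x; exact: z'E.
Qed.

Lemma lim_ext_tors_dlim (T : set R) j X : T 1 ->
  (forall h : dlim (fun k => Ext_map X j (pi k)), h = 0) ->
  lim_ext_tors T std_sys j X.
Proof.
move=> T1 lim0 k g cg; have [f fE] := fun_Hom g.
have fZ : f \in cocycles X j (D k).
  apply/mkSubmodP; apply: val_inj; apply: funext => x; rewrite /= fE.
  exact: cg.
have [d td] := dlim_in_eq0
  (lim0 (dlim_in _ (quot_proj (coboundaries_in X j (D k)) (Sub f fZ)))).
have [z' [tE z'E]] := trans_Ext d (Sub f fZ).
exists 1, d; split => //; move: td; rewrite tE => /Ext_eq0.
by congr (cobound _); apply: funext => x; rewrite z'E /= fE scale1r.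
Qed.

End System.
End ExtCochains.

(** * Inverting one element *)

(** The properties of the module of fractions x / z^k, written [lfrac k x].
The inhabitant constructed below is opaque, which keeps its definition as a
direct limit out of conversion problems. *)
Record localization (R : comNzRingType) (z : R) (X : lmodType R) :=
    Localization {
  lcar :> lmodType R;
  lfrac : nat -> {linear X -> lcar};
  lfrac_surj : forall w, exists k x, lfrac k x = w;
  lfrac_mul : forall k x, lfrac k.+1 (z *: x) = lfrac k x;
  lfrac_eq0 : forall k x, lfrac k x = 0 -> exists d, z ^+ d *: x = 0;
  lfrac_univ : forall (Y : lmodType R) (g : nat -> {linear X -> Y}),
    (forall k x, g k.+1 (z *: x) = g k x) ->
    exists h : {linear lcar -> Y}, forall k x, h (lfrac k x) = g k x }.

Section InvertOne.
Variables (R : comNzRingType) (z : R).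
Implicit Types X Y : lmodType R.

Lemma loc X : localization z X.
Proof.
pose phi (_ : nat) : {linear X -> X} := z \*: idfun.
refine (@Localization _ _ _ (dlim phi)
  (fun k => dlim_in phi (k := k) : {linear X -> dlim phi}) _ _ _ _).
- exact: dlim_surj.
- by move=> k x; exact: (dlim_in_phi phi).
- move=> k x /dlim_in_eq0[d tx]; exists d; rewrite -[RHS]tx.
  elim: d {tx} => [|d IHd] /=; first by rewrite scale1r.
  by rewrite exprS -scalerA IHd.
- by move=> Y g gz; exact: dlim_univ.
Qed.

Lemma lfrac_exp X d k (x : X) :
  lfrac (loc X) (d + k) (z ^+ d *: x) = lfrac (loc X) k x.
Proof.
elim: d => [|d IHd]; first by rewrite scale1r.
by rewrite exprS -scalerA lfrac_mul.
Qed.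

Lemma lfrac_scale X k (x : X) : z *: lfrac (loc X) k.+1 x = lfrac (loc X) k x.
Proof. by rewrite -linearZ/= lfrac_mul. Qed.

Lemma loc_mul_eq0 X (w : loc X) : z *: w = 0 -> w = 0.
Proof.
have [k [x <-]] := lfrac_surj w; rewrite -linearZ => /lfrac_eq0[d].
by rewrite scalerA -exprSr => zx; rewrite -(lfrac_exp d.+1) zx linear0.
Qed.

Lemma loc_mul_surj X (w : loc X) : exists w', z *: w' = w.
Proof.
have [k [x <-]] := lfrac_surj w; exists (lfrac (loc X) k.+1 x); exact: lfrac_scale.
Qed.

Lemma loc_map_ex X Y (f : {linear X -> Y}) : exists h : {linear loc X -> loc Y},
  forall k x, h (lfrac (loc X) k x) = lfrac (loc Y) k (f x).
Proof.
apply: (@lfrac_univ _ _ _ (loc X) _ (fun k => lfrac (loc Y) k \o f)) => k x.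
by rewrite /= linearZ/= lfrac_mul.
Qed.

Definition loc_map X Y (f : {linear X -> Y}) : {linear loc X -> loc Y} :=
  projT1 (cid (loc_map_ex f)).

Lemma loc_mapE X Y (f : {linear X -> Y}) k x :
  loc_map f (lfrac (loc X) k x) = lfrac (loc Y) k (f x).
Proof. exact: (projT2 (cid (loc_map_ex f))). Qed.

End InvertOne.

(** * Cech complexes *)

Section Complexes.
Variable R : comNzRingType.
Implicit Types (X : lmodType R) (C : nat -> lmodType R).

Lemma lin_pair_linear (U V W : lmodType R) (f : {linear U -> V})
  (g : {linear U -> W}) : linear (fun u => (f u, g u)).
Proof. by move=> r x y; rewrite !linearP. Qed.

Definition lin_pair (U V W : lmodType R) (f : {linear U -> V})
    (g : {linear U -> W}) : {linear U -> (V * W)%type} :=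
  mk_linear (lin_pair_linear f g).

Lemma eq_pair_proj (V W : lmodType R) (u v : (V * W)%type) :
  u.1 = v.1 -> u.2 = v.2 -> u = v.
Proof. by case: u v => ? ? [? ?] /= -> ->. Qed.

Definition aug X C (s : nat) : lmodType R := if s is t.+1 then C t else X.

Definition aug_diff X C (i : {linear X -> C 0})
    (d : forall s, {linear C s -> C s.+1}) s : {linear aug X C s -> C s} :=
  match s return {linear aug X C s -> C s} with 0 => i | t.+1 => d t end.

(** A complex X -> C 0 -> C 1 -> ..., with X in position 0 of [caug]. *)
Record coaug X := CoAug {
  cobj : nat -> lmodType R;
  caug0 : {linear X -> cobj 0};
  cdiff : forall s, {linear cobj s -> cobj s.+1};
  cdiffK : forall s x, cdiff s (aug_diff caug0 cdiff s x) = 0 }.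

Definition caug X (K : coaug X) : nat -> lmodType R := aug X (cobj K).

Definition del X (K : coaug X) s : {linear caug K s -> caug K s.+1} :=
  aug_diff (caug0 K) (cdiff K) s.

Lemma delK X (K : coaug X) s x : del K s.+1 (del K s x) = 0.
Proof. exact: cdiffK. Qed.

Definition bnd X (K : coaug X) s : caug K s -> Prop :=
  match s return caug K s -> Prop with
  | 0 => fun x => x = 0
  | t.+1 => fun x => exists e, del K t e = x
  end.

Section Boundaries.
Variables (X : lmodType R) (K : coaug X).

Lemma bnd0 s : bnd (0 : caug K s).
Proof. by case: s => //= s; exists 0; rewrite linear0. Qed.

Lemma bndD s (x y : caug K s) : bnd x -> bnd y -> bnd (x + y).
Proof.
case: s x y => [|s] x y /=; first by move=> -> ->; rewrite addr0.
by move=> [e <-] [f <-]; exists (e + f); rewrite linearD.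
Qed.

Lemma bndZ s r (x : caug K s) : bnd x -> bnd (r *: x).
Proof.
case: s x => [|s] x /=; first by move=> ->; rewrite scaler0.
by move=> [e <-]; exists (r *: e); rewrite linearZ.
Qed.

End Boundaries.

Section Cone.
Variables (X : lmodType R) (K : coaug X) (z : R).

Definition cone_obj s : lmodType R := (cobj K s * loc z (caug K s))%type.

Definition cone_aug : {linear X -> cone_obj 0} :=
  lin_pair (caug0 K) (lfrac (loc z X) 0).

Definition cone_diff s : {linear cone_obj s -> cone_obj s.+1} :=
  lin_pair (cdiff K s \o (fst : {linear cone_obj s -> _}))
    ((lfrac (loc z (cobj K s)) 0 \o (fst : {linear cone_obj s -> _})) \-
     (loc_map z (del K s) \o (snd : {linear cone_obj s -> _}))).

Lemma cone_diffK s x : cone_diff s (aug_diff cone_aug cone_diff s x) = 0.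
Proof.
case: s x => [|s] x; apply: eq_pair_proj => /=.
- exact: (cdiffK (c := K) (s := 0)).
- by rewrite loc_mapE subrr.
- exact: (cdiffK (c := K) (s := s.+1)).
rewrite linearB/= loc_mapE subKr.
have [k [w <-]] := lfrac_surj x.2.
by rewrite !loc_mapE (delK (K := K)) linear0.
Qed.

(** The homotopy fibre of K -> K_z. *)
Definition cone : coaug X := CoAug cone_diffK.

End Cone.

Lemma cone_bnd X (K : coaug X) z t (e : caug K t) :
  bnd (K := cone K z) (s := t.+1) (del K t e, lfrac (loc z (caug K t)) 0 e).
Proof.
case: t e => [|t] e; first by exists e.
by exists ((e, 0) : cone_obj K z t); rewrite /= linear0 subr0.
Qed.

Lemma cone_bnd_loc X (K : coaug X) z t k (u : caug K t) : bnd u ->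
  bnd (K := cone K z) (s := t.+1) ((0, lfrac (loc z (caug K t)) k u) : cone_obj K z t).
Proof.
case: t u => [|t] u; first by move=> /= ->; exists 0; rewrite !linear0.
move=> /= [e <-]; exists ((0, - lfrac (loc z (caug K t)) k e) : cone_obj K z t).
by rewrite /= !linear0 linearN opprK loc_mapE add0r.
Qed.

End Complexes.

Section Cech.
Variable R : comNzRingType.
Implicit Types (X Y D : lmodType R) (y : seq R) (z : R).

Definition const_coaug X : coaug X :=
  @CoAug R X (fun _ => 'rV[R]_0) \0 (fun _ => \0) (fun _ _ => erefl).

Fixpoint cech X y : coaug X :=
  if y is z :: y' then cone (cech X y') z else const_coaug X.

Lemma cech_bound X y s (c : cobj (cech X y) s) : (size y <= s)%N -> c = 0.
Proof.
elim: y s c => [|z y IHy] s c /=; first by move=> _; exact: thinmx0.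
case: s c => [//|s] [c1 c2] ys; have [k [w <-]] := lfrac_surj c2.
by rewrite (IHy s w ys) (IHy s.+1 c1 (ltnW ys)) linear0.
Qed.

(** Some power of [z] is zero on [D], but bijective on [loc z X]. *)
Lemma acyclic_loc D X z k :
  (forall x : D, z ^+ k *: x = 0) -> acyclic (std_res D) (loc z X).
Proof.
move=> zD; apply: acyclic_bij zD _ _.
  elim: k => [|k IHk] w; first by rewrite scale1r.
  by rewrite exprS -scalerA => /loc_mul_eq0; exact: IHk.
elim: k => [|k IHk] w; first by exists w; rewrite scale1r.
have [w' <-] := loc_mul_surj w; have [w'' <-] := IHk w'.
by exists w''; rewrite exprS scalerA.
Qed.

Lemma acyclic_pair (P : proj_complex R) X Y :
  acyclic P X -> acyclic P Y -> acyclic P (X * Y)%type.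
Proof.
move=> aX aY j g cg.
have /aX gX : cocycle ((fst : {linear (X * Y)%type -> _}) \o g).
  by move=> x; rewrite /= cg.
have /aY gY : cocycle ((snd : {linear (X * Y)%type -> _}) \o g).
  by move=> x; rewrite /= cg.
case: j g cg gX gY => [|j] g cg /=; first by move=> gX gY x; apply: (@eq_pair_proj R X Y).
move=> [h hE] [h' h'E]; exists (lin_pair h h') => x.
by apply: (@eq_pair_proj R X Y); [exact: hE|exact: h'E].
Qed.

Lemma cech_acyclic D X y s :
  (forall z, z \in y -> exists k, forall x : D, z ^+ k *: x = 0) ->
  acyclic (std_res D) (cobj (cech X y) s).
Proof.
elim: y s => [|z y IHy] s yD.
  have aT (u v : 'rV[R]_0) : u = v by rewrite thinmx0 [RHS]thinmx0.
  by apply: (@acyclic_bij _ _ _ 0) => [x|c _|c]; [rewrite scale0r| |exists c].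
apply: acyclic_pair.
  by apply: IHy => w wy; apply: yD; rewrite inE wy orbT.
have [|k zD] := yD z; first by rewrite inE eqxx.
exact: acyclic_loc zD.
Qed.

(** Multiplication by [z] is locally homotopic to zero on the cone over [z]. *)
Lemma cone_torsion X (K : coaug X) z s (x : caug (cone K z) s) :
  del (cone K z) s x = 0 -> exists k, bnd (z ^+ k *: x).
Proof.
case: s x => [|t] x dx.
  have /lfrac_eq0[d zx] : lfrac (loc z X) 0 x = 0 := congr1 snd dx.
  by exists d.
case: x dx => c1 c2 dx; have [k [w wE]] := lfrac_surj c2.
have dE : lfrac (loc z (cobj K t)) 0 c1 = lfrac (loc z (cobj K t)) k (del K t w).
  apply/eqP; rewrite -subr_eq0 -loc_mapE wE; apply/eqP.
  exact: (congr1 snd dx).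
have /lfrac_eq0[l zl] : lfrac (loc z (cobj K t)) 0 (z ^+ k *: c1 - del K t w) = 0.
  rewrite linearB linearZ/= dE -linearZ/=.
  by rewrite -(lfrac_exp _ k 0) addn0 subrr.
exists (l + k)%N; rewrite exprD -scalerA.
have -> : z ^+ l *: (z ^+ k *: ((c1, c2) : cone_obj K z t)) =
    z ^+ l *: (del K t w, lfrac (loc z (caug K t)) 0 w).
  apply: eq_pair_proj => /=.
    by apply/eqP; rewrite -subr_eq0 -scalerBr; apply/eqP.
  by congr (_ *: _); rewrite -wE -linearZ/= -(lfrac_exp _ k 0) addn0.
by apply: bndZ; exact: cone_bnd.
Qed.

(** For the head of the sequence this is [cone_torsion].  For another element,
a power of it makes the component of the class in the Cech complex of the tail
a boundary; once that is subtracted, the other component comes from a cocycle of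
the tail. *)
Lemma cech_torsion X y z s (x : caug (cech X y) s) :
  z \in y -> del (cech X y) s x = 0 -> exists k, bnd (z ^+ k *: x).
Proof.
elim: y s x => [//|z' y IHy] s x; rewrite inE => /predU1P[->|zy].
  exact: cone_torsion.
case: s x => [|t] x dx.
  by apply: (IHy 0 x zy); exact: (congr1 fst dx).
case: x dx => c1 c2 dx.
have [|k [e eE]] := IHy t.+1 c1 zy; first exact: (congr1 fst dx).
pose w' := z ^+ k *: c2 - lfrac (loc z' (caug (cech X y) t)) 0 e.
have w'0 : loc_map z' (del (cech X y) t) w' = 0.
  have /= /subr0_eq c12 := congr1 snd dx.
  rewrite /w' linearB/= loc_mapE [del _ _ e]eE !linearZ/= c12.
  by rewrite -scalerDr subrr scaler0.
have [m [w0 w0E]] := lfrac_surj w'.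
have /lfrac_eq0[l zl] : lfrac (loc z' _) m (del (cech X y) t w0) = 0.
  by rewrite -loc_mapE w0E.
have [|k' bk'] := IHy t (z' ^+ l *: w0) zy; first by rewrite linearZ.
exists (k' + k)%N.
have -> : z ^+ (k' + k) *: ((c1, c2) : cone_obj (cech X y) z' t) =
    z ^+ k' *: (del (cech X y) t e, lfrac (loc z' (caug (cech X y) t)) 0 e) +
    (0, lfrac (loc z' (caug (cech X y) t)) (l + m) (z ^+ k' *: (z' ^+ l *: w0))).
  apply: eq_pair_proj => /=.
    by rewrite addr0 eE scalerA -exprD.
  rewrite linearZ/= lfrac_exp w0E /w' scalerBr scalerA -exprD.
  by rewrite addrC subrK.
apply: bndD; first by apply: bndZ; exact: cone_bnd.
exact: cone_bnd_loc.
Qed.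

End Cech.

(** * Coresolutions modulo torsion *)

Section Shift.
Variables (R : comNzRingType) (Y : lmodType R) (K : coaug Y).

Definition coker : lmodType R := quot_type (lin_im (caug0 K)).

Definition to_coker : {linear cobj K 0 -> coker} := quot_proj (lin_im (caug0 K)).

Lemma to_coker_surj w : exists c, to_coker c = w.
Proof. by exists (repr w); exact: quot_projK. Qed.

Lemma to_coker_eq0 c : to_coker c = 0 <-> exists y, caug0 K y = c.
Proof.
have := quotP (lin_im (caug0 K)) c 0; rewrite linear0 subr0 => E.
split=> [/eqP|[y yc]].
  by rewrite [_ == _]E => /mkSubmodP[y _ yc]; exists y.
by apply/eqP; rewrite [_ == _]E; apply/mkSubmodP; exists y.
Qed.

Lemma coker_diff_ex : exists h : {linear coker -> cobj K 1},
  forall c, h (to_coker c) = cdiff K 0 c.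
Proof.
apply: lin_factor => [|c /to_coker_eq0[y <-]]; first exact: to_coker_surj.
exact: (delK (K := K) (s := 0)).
Qed.

Definition coker_diff : {linear coker -> cobj K 1} := projT1 (cid coker_diff_ex).

Lemma coker_diffE c : coker_diff (to_coker c) = cdiff K 0 c.
Proof. exact: (projT2 (cid coker_diff_ex)). Qed.

Lemma shiftK s x :
  cdiff K s.+1 (aug_diff (C := fun s => cobj K s.+1) coker_diff
                  (fun s => cdiff K s.+1) s x) = 0.
Proof.
case: s x => [|s] x /=; last exact: (delK (K := K) (s := s.+2)).
have [c <-] := to_coker_surj x; rewrite coker_diffE.
exact: (delK (K := K) (s := 1)).
Qed.

(** The complex coker -> C 1 -> C 2 -> ..., which has the cohomology of
Y -> C 0 -> C 1 -> ... but for that at Y. *)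
Definition shift : coaug coker := CoAug shiftK.

Lemma bnd_shift0 c : bnd (K := shift) (s := 0) (to_coker c) <-> bnd (K := K) (s := 1) c.
Proof. exact: to_coker_eq0. Qed.

Lemma bnd_shiftS s (x : cobj K s.+1) :
  bnd (K := shift) (s := s.+1) x <-> bnd (K := K) (s := s.+2) x.
Proof.
case: s x => [|s] x; last by [].
split=> [[w <-]|[c <-]]; last by exists (to_coker c); exact: coker_diffE.
by have [c <-] := to_coker_surj w; exists c; rewrite [RHS]coker_diffE.
Qed.

End Shift.

Section Coresolution.
Variables (R : comNzRingType) (T : set R).
Hypothesis (TM : forall s t, T s -> T t -> T (s * t)).
Implicit Types Y : lmodType R.

Definition exact_tors Y (K : coaug Y) s : Prop := forall x : caug K s,
  del K s x = 0 -> exists t, T t /\ bnd (t *: x).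

Lemma exact_tors_ker Y (K : coaug Y) :
  exact_tors K 0 -> tors T (submod_type (lin_ker (caug0 K))).
Proof.
move=> ex0 y; have [t [Tt ty]] := ex0 (\val y) (lin_ker_val y).
by exists t; split => //; apply: val_inj; rewrite linearZ.
Qed.

Lemma exact_tors_shift Y (K : coaug Y) s :
  exact_tors K s.+1 <-> exact_tors (shift K) s.
Proof.
case: s => [|s]; split=> ex x dx.
- have [c cx] := to_coker_surj x; subst x.
  have [|t [Tt tc]] := ex c; first by rewrite -[RHS]dx; exact/esym/coker_diffE.
  by exists t; split => //; rewrite -linearZ; apply/bnd_shift0.
- have [|t [Tt tc]] := ex (to_coker K x); first by rewrite -[RHS]dx; exact: coker_diffE.
  by exists t; split => //; apply/bnd_shift0; rewrite linearZ.
- have [t [Tt tc]] := ex x dx.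
  by exists t; split => //; exact: (bnd_shiftS (K := K) (s := s) _).2.
- have [t [Tt tc]] := ex x dx.
  by exists t; split => //; exact: (bnd_shiftS (K := K) (s := s) _).1.
Qed.

(** Dimension shifting along the coresolution, from its last term backwards. *)
Lemma ext_tors_coresolution (P : proj_complex R) Y (K : coaug Y) N :
  (forall V, tors T V -> forall j, ext_tors T j P V) ->
  (forall s j, ext_tors T j P (cobj K s)) ->
  (forall s, exact_tors K s) ->
  (forall s (c : cobj K s), (N <= s)%N -> c = 0) ->
  forall j, ext_tors T j P Y.
Proof.
move=> PF; elim: N Y K => [|N IHN] Y K acK exK bK.
  apply: PF => y; have [|t [Tt ty]] := exK 0%N y; last by exists t.
  exact: bK.
apply: (ext_tors_sub TM (i := caug0 K) (q := to_coker K)) => //.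
- exact: to_coker_surj.
- by move=> y; apply/to_coker_eq0; exists y.
- by move=> c /to_coker_eq0.
- by move=> j; apply: PF; exact: exact_tors_ker.
apply: (IHN _ (shift K)) => [s|s|s c sN]; first exact: (acK s.+1).
  exact: (exact_tors_shift K s).1.
exact: (bK s.+1 c sN).
Qed.

Variables (D : nat -> proj_complex R).
Variable pi : forall k j, {linear D k.+1 j -> D k j}.
Hypothesis pi_diff : forall k j x,
  pi k j (pdiff _ _ x) = pdiff _ _ (pi k j.+1 x).
Hypothesis D_tors : forall k V, tors T V -> forall j, ext_tors T j (D k) V.
Variable I : nat -> set R.
Hypothesis I_tors : forall Y, lim_ext_tors T pi 0 Y ->
  forall (y : Y) k, (forall r, I k r -> r *: y = 0) -> exists t, T t /\ t *: y = 0.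

(** In position 0 the cohomology is a submodule of [Y] that is torsion for the
ideals I k, so it is controlled by the limit of the Hom(D k, Y).  When it
vanishes, pass to the cokernel of Y -> C 0, which lowers all degrees by one. *)
Lemma exact_tors_lim Y (K : coaug Y) N :
  (forall k s j, ext_tors T j (D k) (cobj K s)) ->
  (forall s (x : caug K s), del K s x = 0 ->
     exists t k, T t /\ forall r, I k r -> bnd (r *: (t *: x))) ->
  (forall j, (j < N)%N -> lim_ext_tors T pi j Y) ->
  forall s, (s < N)%N -> exact_tors K s.
Proof.
elim: N Y K => [//|N IHN] Y K acK torK limY.
have ex0 : exact_tors K 0.
  move=> x dx; have [t [k [Tt bt]]] := torK 0%N x dx.
  have [u [Tu ut]] := I_tors (limY 0%N isT) bt.
  by exists (u * t); split; [exact: TM|rewrite -scalerA].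
case=> [//|s] sN; apply/exact_tors_shift; apply: IHN sN.
- by move=> k s' j; exact: (acK k s'.+1).
- case=> [|s'] x dx.
    have [c cx] := to_coker_surj x; subst x.
    have [|t [k [Tt bt]]] := torK 1%N c.
      by rewrite -[RHS]dx; exact/esym/coker_diffE.
    exists t, k; split => // r Ir; have /bnd_shift0 := bt r Ir.
    by do 2!rewrite [to_coker K (_ *: _)]linearZ/=.
  have [t [k [Tt bt]]] := torK s'.+2 x dx.
  exists t, k; split => // r Ir.
  exact: (bnd_shiftS (K := K) (s := s') _).2 (bt r Ir).
move=> j jN; apply: (lim_ext_tors_quot TM (i := caug0 K) (q := to_coker K)) => //.
- exact: to_coker_surj.
- by move=> y; apply/to_coker_eq0; exists y.
- by move=> c /to_coker_eq0.
- by move=> k; apply: D_tors; exact: exact_tors_ker.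
exact: limY.
Qed.

End Coresolution.

(** * Prime ideals of a noetherian ring *)

Section Primes.
Variable R : comNzRingType.
Implicit Types (I J A : submodClosed R^o) (P Q T : set R).

Record prime_set P : Prop := PrimeSet {
  prime0 : P 0;
  primeD : forall x y, P x -> P y -> P (x + y);
  primeMl : forall r x, P x -> P (r * x);
  prime1 : ~ P 1;
  primeM : forall x y, P (x * y) -> P x \/ P y }.

Lemma prime_idealr_set (p : prime_idealr R) : prime_set [set` p].
Proof.
split => /=; first exact: idealr0.
- by move=> x y px py; rewrite rpredD.
- by move=> r x px; exact: idealMr.
- by rewrite idealr1.
- by move=> x y; rewrite prime_idealrM => /orP.
Qed.

Lemma prime_setX P x k : prime_set P -> P (x ^+ k) -> P x.
Proof.
move=> pP; elim: k => [/(prime1 pP)//|k IHk].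
by rewrite exprS => /(primeM pP)[].
Qed.

Lemma prime_set_idealr P : prime_set P -> exists p : prime_idealr R, P = [set` p].
Proof.
move=> [P0 PD PM P1 PP]; pose p x := `[< P x >].
have pI : idealr_closed p.
  split; first exact/asboolP; first exact/asboolPn.
  by move=> a u v /asboolP Pu /asboolP Pv; apply/asboolP/PD => //; exact: PM.
have pp : prime_idealr_closed p.
  move=> u v /asboolP/PP[Pu|Pv]; apply/orP; [left|right]; exact/asboolP.
exists (HB.pack_for (prime_idealr R) p (isIdealr.Build R p pI)
  (isPrimeIdealrClosed.Build R p pp)).
by apply/seteqP; split=> x /=; [move=> Px; exact/asboolP|move=> /asboolP].
Qed.

Lemma ideal_add I (x : R^o) : exists J, [/\ {subset I <= J}, x \in J &
  forall u : R^o, u \in J -> exists (r : R) v, v \in I /\ u = r *: x + v].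
Proof.
pose P := [set u : R^o | exists (r : R) v, v \in I /\ u = r *: x + v].
have P0 : P 0 by exists 0, 0; rewrite rpred0 scale0r addr0.
have PD u v : P u -> P v -> P (u + v).
  move=> [r [u' [Iu ->]]] [s [v' [Iv ->]]]; exists (r + s), (u' + v').
  by split; [exact: rpredD|rewrite scalerDl addrACA].
have PZ r u : P u -> P (r *: u).
  move=> [s [u' [Iu ->]]]; exists (r * s), (r *: u').
  by split; [exact: rpredZ|rewrite scalerDr scalerA].
exists (mkSubmod P0 PD PZ); split=> [u Iu||u /mkSubmodP//].
  by apply/mkSubmodP; exists 0, u; rewrite scale0r add0r.
by apply/mkSubmodP; exists 1, 0; rewrite rpred0 scale1r addr0.
Qed.

Lemma ideal_mull I (r x : R) : (x : R^o) \in I -> (r * x : R^o) \in I.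
Proof. exact: (rpredZ r). Qed.

Hypothesis noethR : noetherian R.

(** Without a maximal element, dependent choice gives a strictly increasing
sequence, whose union is not finitely generated. *)
Lemma noetherian_max (Q : submodClosed R^o -> Prop) : (exists I, Q I) ->
  exists I, Q I /\ forall J, Q J -> {subset I <= J} -> {subset J <= I}.
Proof.
move=> [I0 QI0]; apply: contrapT => nomax.
have step (I : {I | Q I}) : exists J : {J | Q J},
    {subset sval I <= sval J} /\ ~ {subset sval J <= sval I}.
  case: I => I QI /=; apply: contrapT => nstep; apply: nomax; exists I; split => //.
  move=> J QJ IJ; apply: contrapT => nJI; apply: nstep.
  by exists (exist _ J QJ).
have [f fP] := choice step.
pose c k : submodClosed R^o := sval (iter k f (exist _ I0 QI0)).
have cS k : {subset c k <= c k.+1} by have [] := fP (iter k f (exist _ I0 QI0)).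
have cn k : ~ {subset c k.+1 <= c k} by have [] := fP (iter k f (exist _ I0 QI0)).
have cD d k : {subset c k <= c (d + k)%N}.
  by elim: d => [//|d IHd] x /IHd; exact: cS.
have cle k l : (k <= l)%N -> {subset c k <= c l}.
  by move=> kl; rewrite -(subnK kl); exact: cD.
pose U := [set x : R^o | exists k, x \in c k].
have U0 : U 0 by exists 0%N; rewrite rpred0.
have UD x y : U x -> U y -> U (x + y).
  move=> [k xk] [l yl]; exists (maxn k l).
  by apply: rpredD; [apply: cle xk; exact: leq_maxl|apply: cle yl; exact: leq_maxr].
have UZ (r : R) x : U x -> U (r *: x) by move=> [k xk]; exists k; exact: rpredZ.
have [s sU] := noethR (mkSubmod U0 UD UZ).
have [K sK] : exists K, forall x, x \in s -> x \in c K.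
  have : forall x, x \in s -> U x.
    by move=> x xs; apply/(mkSubmodP U0 UD UZ); rewrite sU; exact: mem_span.
  elim: (s) => [|x l IHl] lU; first by exists 0%N.
  have [|K lK] := IHl; first by move=> y yl; apply: lU; rewrite inE yl orbT.
  have [k xk] := lU x (mem_head _ _); exists (maxn k K) => y.
  rewrite inE => /predU1P[->|/lK]; first by apply: cle xk; exact: leq_maxl.
  by apply: cle; exact: leq_maxr.
apply: (cn K) => x xK; apply: (span_seq sK); rewrite -sU.
by apply/mkSubmodP; exists K.+1.
Qed.

(** Any ideal maximal among those containing [A] and disjoint from the
multiplicative set [T] is prime: for x and y outside it, it meets [T] after x is
added, and after y is, but not after x y is. *)
Lemma prime_separation A T : T 1 -> (forall s t, T s -> T t -> T (s * t)) ->
  (forall t : R^o, T t -> t \notin A) ->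
  exists P, [/\ prime_set P, forall r : R^o, r \in A -> P r &
    forall t, T t -> ~ P t].
Proof.
move=> T1 TM TA.
have [|I [[AI TI] maxI]] := @noetherian_max (fun I =>
    {subset A <= I} /\ forall t : R^o, T t -> t \notin I); first by exists A; split.
have meet (x : R^o) : x \notin I -> exists (r : R) v, v \in I /\ T (r *: x + v).
  move=> xI; have [J [IJ xJ JP]] := ideal_add I x.
  apply: contrapT => nT; case/negP: xI; apply: (maxI J _ IJ _ xJ).
  split=> [r /AI/IJ//|t Tt]; apply/negP => /JP[r [v [Iv tE]]]; apply: nT.
  by exists r, v; rewrite -tE.
exists [set r : R | (r : R^o) \in I]; split.
- split=> /=; first exact: (rpred0 I).
  + by move=> x y; exact: (@rpredD _ I).
  + by move=> r x; exact: ideal_mull.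
  + by move=> I1; have := TI _ T1; rewrite I1.
  move=> x y xyI; apply: contrapT => /not_orP[/negP/meet[r [u [Iu Tu]]]].
  move=> /negP/meet[s [v [Iv Tv]]]; have := TI _ (TM _ _ Tu Tv).
  have -> : (r *: (x : R^o) + u) * (s *: (y : R^o) + v) =
      (r * s) * (x * y) + (r * x) * v + (s * y + v) * u :> R.
    by rewrite [LHS]mulrDl mulrDr [u * _]mulrC mulrACA.
  by case/negP; do !apply: rpredD; exact: ideal_mull.
- by move=> r /AI.
- by move=> t /TI/negP.
Qed.

(** An ideal maximal among the counterexamples is not prime: it contains some
x y but neither x nor y, and the lists for the ideals obtained by adding x and
by adding y together serve for it. *)
Lemma finite_minimal_primes I : exists l : seq (set R),
  (forall P, P \in l -> prime_set P /\ forall r : R^o, r \in I -> P r) /\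
  forall P, prime_set P -> (forall r : R^o, r \in I -> P r) ->
    exists2 Q, Q \in l & Q `<=` P.
Proof.
apply: contrapT => nI.
have [|{nI}J [nJ maxJ]] := @noetherian_max (fun I => ~ exists l : seq (set R),
  (forall P, P \in l -> prime_set P /\ forall r : R^o, r \in I -> P r) /\
  forall P, prime_set P -> (forall r : R^o, r \in I -> P r) ->
    exists2 Q, Q \in l & Q `<=` P); first by exists I.
have sub (x : R^o) : x \notin J -> exists l : seq (set R),
  (forall P, P \in l -> prime_set P /\ forall r : R^o, r \in J -> P r) /\
  forall P, prime_set P -> (forall r : R^o, r \in J -> P r) -> P x ->
    exists2 Q, Q \in l & Q `<=` P.
  move=> xJ; have [K [JK xK KP]] := ideal_add J x.
  have [l [lK Kl]] : exists l : seq (set R),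
    (forall P, P \in l -> prime_set P /\ forall r : R^o, r \in K -> P r) /\
    forall P, prime_set P -> (forall r : R^o, r \in K -> P r) ->
    exists2 Q, Q \in l & Q `<=` P.
    by apply: contrapT => nK; case/negP: xJ; exact: (maxJ K nK JK).
  exists l; split=> [P /lK[pP KP']|P pP JP Px]; first by split=> // r /JK/KP'.
  apply: Kl => // u /KP[r [v [Jv ->]]]; apply: (primeD pP); last exact: JP.
  exact: primeMl.
apply: nJ; have [J1|J1] := boolP ((1 : R^o) \in J).
  exists [::]; split=> // P pP JP; by case: (prime1 pP); exact: JP.
have [[x [y [xJ yJ xyJ]]]|noxy] := pselect (exists x y : R,
    [/\ (x : R^o) \notin J, (y : R^o) \notin J & (x * y : R^o) \in J]).
  have [l [lJ Jl]] := sub x xJ; have [l' [lJ' Jl']] := sub y yJ.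
  exists (l ++ l'); split=> [P|P pP JP].
    by rewrite mem_cat => /orP[/lJ|/lJ'].
  have [Px|Py] := primeM pP (JP _ xyJ).
    by have [Q Ql QP] := Jl P pP JP Px; exists Q; rewrite // mem_cat Ql.
  by have [Q Ql QP] := Jl' P pP JP Py; exists Q; rewrite // mem_cat Ql orbT.
exists [:: [set r : R | (r : R^o) \in J]]; split=> [P|P pP JP]; last first.
  by exists [set r : R | (r : R^o) \in J]; [rewrite inE|move=> r; exact: JP].
rewrite inE => /eqP ->; split=> //; split=> /=; first exact: (rpred0 J).
- by move=> x y; exact: (@rpredD _ J).
- by move=> r x; exact: ideal_mull.
- exact/negP.
move=> x y xy; apply: contrapT => /not_orP[/negP xJ /negP yJ].
by apply: noxy; exists x, y.
Qed.

End Primes.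

(** * Heights and the exceptional primes *)

Section Heights.
Variable R : comNzRingType.
Implicit Types (I a : submodClosed R^o) (P Q : set R) (y : seq R) (z : R).

Fixpoint htge (d : nat) P : Prop :=
  if d is d'.+1 then prime_set P /\ exists2 Q, htge d' Q & Q `<` P
  else prime_set P.

Lemma htge_prime d P : htge d P -> prime_set P.
Proof. by case: d => [//|d] []. Qed.

Lemma htge_chain d P : htge d P ->
  exists p : nat -> prime_idealr R, prime_chain d p /\ [set` p d] = P.
Proof.
elim: d P => [|d IHd] P.
  by move=> /prime_set_idealr[p pP]; exists (fun=> p).
move=> [pP [Q /IHd[p [pc pQ]] QP]]; have [q qP] := prime_set_idealr pP.
exists (fun k => if (k <= d)%N then p k else q); split; last by rewrite ltnn.
move=> k kd; have [->|nkd] := eqVneq k d; first by rewrite /= leqnn ltnn pQ -qP.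
have {nkd}kd : (k < d)%N by rewrite ltn_neqAle nkd -ltnS.
by rewrite /= (ltnW kd) kd; exact: pc.
Qed.

(** The primes of height at most [size y] at which the top local cohomology with
respect to the elements of [y] may fail to vanish, as [cech_top] shows. *)
Fixpoint exc y : set (set R) :=
  if y is z :: y' then
    [set P | [/\ prime_set P, P z & exists Q, [/\ exc y' Q, Q `<=` P, ~ Q z &
      forall P', prime_set P' -> Q `<=` P' -> P' z -> P' `<=` P -> P `<=` P']]]
  else [set P | prime_set P /\ ~ htge 1 P].

Lemma exc_htge y P : exc y P -> htge (size y) P.
Proof.
elim: y P => [|z y IHy] P /=; first by case.
move=> [pP Pz [Q [/IHy hQ QP nQz _]]]; split => //; exists Q => //.
by split=> // PQ; apply: nQz; exact: PQ.
Qed.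

Hypothesis noethR : noetherian R.

Lemma prime_set_submod P : prime_set P ->
  exists I : submodClosed R^o, forall r : R^o, r \in I <-> P r.
Proof.
move=> [P0 PD PM _ _].
exists (@mkSubmod R R^o P P0 PD PM) => r.
by split=> [/mkSubmodP|Pr] //; apply/mkSubmodP.
Qed.

Lemma exc_finite y : finite_set (exc y).
Proof.
elim: y => [|z y IHy] /=.
  have [l [lP Pl]] := finite_minimal_primes noethR (submod_span set0).
  apply: (@sub_finite_set _ _ [set` l]); last exact: finite_seq.
  move=> P [pP nP]; have [|Q Ql QP] := Pl P pP.
    have [I IP] := prime_set_submod pP.
    by move=> r /(span_sub (S := I)) rI; apply/IP; apply: rI.
  suff -> : P = Q by [].
  apply/seteqP; split=> //; apply: contrapT => nPQ; apply: nP; split => //.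
  by exists Q => //; have [] := lP Q Ql.
pose F Q := [set P | [/\ prime_set P, P z, Q `<=` P &
  forall P', prime_set P' -> Q `<=` P' -> P' z -> P' `<=` P -> P `<=` P']].
apply: (@sub_finite_set _ _ (\bigcup_(Q in exc y) F Q)).
  by move=> P [pP Pz [Q [eQ QP _ minP]]]; exists Q.
apply: bigcup_finite => // Q /exc_htge/htge_prime pQ.
have [I IQ] := prime_set_submod pQ; have [J [IJ zJ JP]] := ideal_add I (z : R^o).
have [l [lP Pl]] := finite_minimal_primes noethR J.
apply: (@sub_finite_set _ _ [set` l]); last exact: finite_seq.
move=> P [pP Pz QP minP]; have [|P' P'l P'P] := Pl P pP.
  move=> r /JP[s [v [Iv ->]]]; apply: (primeD pP); first exact: primeMl.
  by apply: QP; apply/IQ.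
have [pP' P'J] := lP P' P'l; suff -> : P = P' by [].
apply/seteqP; split=> //; apply: minP => //; last exact: P'J.
by move=> r /IQ/IJ/P'J.
Qed.

Lemma primeB P x w : prime_set P -> P (x + w) -> P x -> P w.
Proof.
move=> pP Pxw Px; rewrite -[w](addKr x); apply: (primeD pP) => //.
by rewrite -mulN1r; exact: primeMl.
Qed.

(** If the element [x] that avoids the primes of [l] not contained in [q] lies in
[q], add to it some [w] of [I] outside [q] that lies in all of those; the primes
contained in [q] are avoided along with it. *)
Lemma prime_avoidance I (l : seq (set R)) :
  (forall P, P \in l -> prime_set P /\ exists2 r : R^o, r \in I & ~ P r) ->
  exists2 x : R^o, x \in I & forall P, P \in l -> ~ P x.
Proof.
have [n] := ubnP (size l); elim: n l => // n IHn [_ _|q l].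
  by exists 0 => //; exact: rpred0.
rewrite ltnS => ln lI.
pose l1 := [seq P <- l | ~~ `[< P `<=` q >]].
have [||x Ix l1x] := IHn l1; first by rewrite size_filter (leq_ltn_trans (count_size _ _)).
  by move=> P; rewrite mem_filter => /andP[_ Pl]; apply: lI; rewrite inE Pl orbT.
have [pq [r0 Ir0 qr0]] := lI q (mem_head _ _).
have [qx|nqx] := pselect (q x); last first.
  exists x => // P; rewrite inE => /predU1P[->//|Pl] Px.
  have [/asboolP Pq|nPq] := boolP `[< P `<=` q >]; first exact/nqx/Pq.
  by apply: l1x Px; rewrite mem_filter nPq.
have [w [Iw nqw l1w]] : exists w : R^o,
    [/\ w \in I, ~ q w & forall P, P \in l1 -> P w].
  have : forall P, P \in l1 -> prime_set P /\ ~ P `<=` q.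
    move=> P; rewrite mem_filter => /andP[/asboolPn nPq Pl]; split => //.
    by have [|] := lI P; rewrite // inE Pl orbT.
  elim: (l1) => [|P l' IHl] l'P; first by exists r0.
  have [|w [Iw nqw l'w]] := IHl; first by move=> Q Ql; apply: l'P; rewrite inE Ql orbT.
  have [pP nPq] := l'P P (mem_head _ _).
  have [t Pt nqt] : exists2 t, P t & ~ q t.
    apply: contrapT => nt; apply: nPq => t Pt; apply: contrapT => qt.
    by apply: nt; exists t.
  exists (t * w); split; first exact: ideal_mull.
    by move=> /(primeM pq)[].
  move=> Q; rewrite inE => /predU1P[->|Ql]; first by rewrite mulrC; exact: primeMl.
  have [pQ _] : prime_set Q /\ ~ Q `<=` q by apply: l'P; rewrite inE Ql orbT.
  by apply: primeMl => //; exact: l'w.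
exists (x + w); first exact: rpredD.
move=> P; rewrite inE => /predU1P[->|Pl] Pxw.
  by apply: nqw; exact: primeB pq Pxw qx.
have [/asboolP Pq|nPq] := boolP `[< P `<=` q >].
  by apply: nqw; apply: (primeB pq) qx; exact: Pq.
have Pl1 : P \in l1 by rewrite mem_filter nPq.
have [pP _] := lI P (mem_behead (s := q :: l) Pl).
apply: (l1x P Pl1); apply: (primeB (x := w) pP); first by rewrite addrC.
exact: l1w.
Qed.

(** Each new element avoids the minimal primes over the previous ones that do
not contain [a]; hence a prime that contains them all, but not [a], lies
strictly above such a minimal prime, and its height has grown by one. *)
Lemma exists_parameters a i : exists y, [/\ size y = i,
  forall z : R^o, z \in y -> z \in a &
  forall Q, prime_set Q -> (forall z, z \in y -> Q z) -> ~ htge i Q ->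
    forall r : R^o, r \in a -> Q r].
Proof.
elim: i => [|i [y [sy ya yQ]]]; first by exists [::]; split=> // Q pQ _ [].
have [l [lP Pl]] :=
  finite_minimal_primes noethR (submod_span [set` (y : seq R^o)]).
pose l1 := [seq P <- l | ~~ `[< forall r : R^o, r \in a -> P r >]].
have [|z za zl1] := @prime_avoidance a l1.
  move=> P; rewrite mem_filter => /andP[/asboolPn naP Pl0]; split.
    by have [] := lP P Pl0.
  apply: contrapT => nr; apply: naP => r ra; apply: contrapT => Pr.
  by apply: nr; exists r.
exists (z :: y); split=> [|u|Q pQ Qzy nhQ r ra]; first by rewrite /= sy.
  by rewrite inE => /predU1P[->|/ya].
apply: contrapT => nQr; apply: nhQ; split => //.
have [I IQ] := prime_set_submod pQ.
have [|P Pl0 PQ] := Pl Q pQ.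
  move=> s ys; apply/IQ; apply: span_seq ys => u uy; apply/IQ.
  by apply: Qzy; rewrite inE uy orbT.
have [pP yP] := lP P Pl0.
have naP : ~ forall r : R^o, r \in a -> P r by move=> /(_ r ra)/PQ.
exists P; last first.
  split=> // QP; apply: (zl1 P); last by apply: QP; apply: Qzy; exact: mem_head.
  by rewrite mem_filter Pl0 andbT; exact/asboolPn.
apply: contrapT => nhP; apply: naP; apply: yQ => // u uy; apply: yP.
exact: mem_span.
Qed.

(** The colon ideals (B : a^k) become stationary, at a B' with (B' : a) = B'.
Were B' proper, multiplying an element outside B' by suitable powers of the
generators of [a] would give an element of (B' : a) outside B'. *)
Lemma ideal_exp_sub a (gs : seq R^o) (B : submodClosed R^o) :
  {subset a <= submod_span [set` gs]} ->
  (forall g, g \in gs -> exists N, ((g : R) ^+ N : R^o) \in B) ->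
  exists k, {subset ideal_exp a k <= B}.
Proof.
move=> ags gB.
have colonP k : exists C : submodClosed R^o, forall r : R^o,
    r \in C <-> forall x : R^o, x \in ideal_exp a k -> (r : R) * x \in B.
  pose Q := [set r : R^o |
    forall x : R^o, x \in ideal_exp a k -> (r : R) * x \in B].
  have Q0 : Q 0 by move=> x _; rewrite mul0r; exact: (rpred0 B).
  have QD r s : Q r -> Q s -> Q (r + s).
    by move=> Qr Qs x xa; rewrite mulrDl; apply: (@rpredD _ B); [exact: Qr|exact: Qs].
  have QZ (r : R) s : Q s -> Q (r *: s).
    by move=> Qs x xa; rewrite -mulrA; apply: ideal_mull; exact: Qs.
  by exists (mkSubmod Q0 QD QZ) => r; split=> [/mkSubmodP|Qr] //; apply/mkSubmodP.
have [C CP] := choice colonP.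
have [|J [[k JC] maxJ]] := noetherian_max noethR (Q := fun I => exists k, I =i C k).
  by exists (C 0%N), 0%N.
have CSk : {subset C k.+1 <= C k}.
  move=> x xC; rewrite -JC; apply: (maxJ (C k.+1)) => //; first by exists k.+1.
  move=> u; rewrite JC => /CP uk; apply/CP => v /ideal_mul_subr; exact: uk.
have [C1|nC1] := boolP ((1 : R^o) \in C k).
  by exists k => x xa; rewrite -[x]mul1r; move/CP: C1; apply.
(* Now B' = C k is proper; such an [r] would be in (B' : a) but not in B'. *)
suff [r nCr rgs] : exists2 r : R^o, r \notin C k &
    forall g, g \in gs -> ((r : R) * g : R^o) \in C k.
  case/negP: nCr; apply: CSk; apply/CP => x.
  pose Q := [set x : R^o | (r : R) * x \in B].
  have Q0 : Q 0 by rewrite /Q /= mulr0; exact: (rpred0 B).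
  have QD u v : Q u -> Q v -> Q (u + v).
    by rewrite /Q /= mulrDr; exact: (@rpredD _ B).
  have QZ (c : R) u : Q u -> Q (c *: u).
    by rewrite /Q /= => Qu; rewrite mulrCA; exact: ideal_mull.
  suff sQ : {subset ideal_exp a k.+1 <= mkSubmod Q0 QD QZ} by move=> /sQ/mkSubmodP.
  apply: span_sub => _ [u [v [ua va ->]]]; apply/mkSubmodP; rewrite /Q /= mulrA.
  suff : (r : R) * u \in C k by move=> /CP; apply.
  pose Q' := [set x : R^o | (r : R) * x \in C k].
  have Q'0 : Q' 0 by rewrite /Q' /= mulr0; exact: (rpred0 (C k)).
  have Q'D s t : Q' s -> Q' t -> Q' (s + t).
    by rewrite /Q' /= mulrDr; exact: (@rpredD _ (C k)).
  have Q'Z (c : R) s : Q' s -> Q' (c *: s).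
    by rewrite /Q' /= => Qu; rewrite mulrCA; exact: ideal_mull.
  change (Q' u); apply/(mkSubmodP Q'0 Q'D Q'Z).
  by apply: span_seq (ags u ua) => g /rgs rg; apply/mkSubmodP.
elim: gs gB {ags} => [|g gs IHgs] gB; first by exists 1.
have [|r nCr rgs] := IHgs; first by move=> h hgs; apply: gB; rewrite inE hgs orbT.
have [N gN] := gB g (mem_head _ _).
have gNC : ((r : R) * (g : R) ^+ N : R^o) \in C k.
  apply: ideal_mull; apply/CP => x _; rewrite mulrC; exact: ideal_mull.
have [M gM minM] := ex_minnP
  (ex_intro (fun N => ((r : R) * (g : R) ^+ N : R^o) \in C k) N gNC).
case: M gM minM => [|M] gM minM.
  by case/negP: nCr; move: gM; rewrite expr0 mulr1.
exists ((r : R) * (g : R) ^+ M).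
  by apply/negP => /minM; rewrite ltnn.
move=> h; rewrite inE => /predU1P[->|/rgs rh]; first by rewrite -mulrA -exprSr.
by rewrite mulrAC mulrC; exact: ideal_mull.
Qed.

End Heights.

(** * Cohomology of the Cech complex at a prime *)

Section Local.
Variable R : comNzRingType.
Hypothesis noethR : noetherian R.
Implicit Types (X D : lmodType R) (P Q : set R) (y : seq R).

Definition outside P : set R := [set s | ~ P s].

Lemma outside1 P : prime_set P -> outside P 1.
Proof. exact: prime1. Qed.

Lemma outsideM P s t : prime_set P -> outside P s -> outside P t -> outside P (s * t).
Proof. by move=> pP Ps Pt /(primeM pP)[]. Qed.

Lemma ann_bnd X (K : coaug X) s (x : caug K s) :
  exists A : submodClosed R^o, forall r : R^o, r \in A <-> bnd ((r : R) *: x).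
Proof.
pose Q := [set r : R^o | bnd ((r : R) *: x)].
have Q0 : Q 0 by rewrite /Q /= scale0r; exact: bnd0.
have QD u v : Q u -> Q v -> Q (u + v).
  by rewrite /Q /= scalerDl; exact: bndD.
have QZ (c : R) u : Q u -> Q (c *: u).
  by rewrite /Q /= -scalerA; exact: bndZ.
by exists (mkSubmod Q0 QD QZ) => r; split=> [/mkSubmodP|Qr] //; apply/mkSubmodP.
Qed.

(** This is used for the annihilator [A] of a class: if the class survives the
inversion of [z] and localization at [P], then its support contains a prime
below [P] at which [z] is invertible. *)
Lemma prime_under P (A : submodClosed R^o) z : prime_set P ->
  (forall s k, outside P s -> ((s * z ^+ k : R) : R^o) \notin A) ->
  exists Q, [/\ prime_set Q, forall r : R^o, r \in A -> Q r, Q `<=` P & ~ Q z].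
Proof.
move=> pP szA.
have [|||Q [pQ AQ TQ]] := @prime_separation R noethR A
    [set t | exists s k, outside P s /\ t = s * z ^+ k].
- by exists 1, 0%N; rewrite mulr1; split => //; exact: outside1.
- move=> _ _ [s [k [Ps ->]]] [t [l [Pt ->]]]; exists (s * t), (k + l)%N.
  by rewrite exprD mulrACA; split => //; exact: outsideM.
- by move=> _ [s [k [Ps ->]]]; exact: szA.
exists Q; split => //.
  move=> r Qr; apply: contrapT => Pr; apply: (TQ r) => //.
  by exists r, 0%N; rewrite mulr1.
by move=> Qz; apply: (TQ z) => //; exists 1, 1%N; rewrite mul1r; split=> //; exact: outside1.
Qed.

(** The top cohomology of the cone over [z] is a quotient of N_z, where N is the
top cohomology for the other elements.  If it does not vanish at [P], some prime
[Q] below [P] supports N and does not contain [z]; by induction it belongs to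
[exc], so that its height is at least the length of the sequence, and no prime
fits strictly between [Q] and [P]. *)
Lemma cech_top X y P : prime_set P -> ~ htge (size y).+1 P -> ~ exc y P ->
  forall x : caug (cech X y) (size y),
    exists t, outside P t /\ bnd (t *: x).
Proof.
elim: y P => [|z y IHy] P pP hP eP x; first by case: eP.
have [Pz|nPz] := pselect (P z); last first.
  have [|k zx] := @cech_torsion R X (z :: y) z _ x (mem_head _ _).
    exact: (cech_bound (y := z :: y)).
  by exists (z ^+ k); split => //; move/(prime_setX pP).
case: x => c w.
have -> : c = 0 by exact: cech_bound.
have [k [w0 <-]] := lfrac_surj w.
(* The class of [w0] in N, and its annihilator. *)
have [A AP] := ann_bnd (w0 : caug (cech X y) (size y)).
have [[s [l [Ps /AP bw0]]]|nsz] := pselect (exists s l,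
    outside P s /\ ((s * z ^+ l : R) : R^o) \in A).
  exists s; split => //.
  have -> : s *: ((0, lfrac (loc z (caug (cech X y) (size y))) k w0)
      : cone_obj (cech X y) z (size y)) =
    (0, lfrac (loc z (caug (cech X y) (size y))) (l + k) ((s * z ^+ l) *: w0)).
    apply: eq_pair_proj => /=; first exact: scaler0.
    by rewrite -scalerA linearZ/= lfrac_exp.
  exact: cone_bnd_loc.
have [||Q [pQ AQ QP nQz]] := @prime_under P A z.
- exact: pP.
- by move=> s l Ps; apply/negP => szA; apply: nsz; exists s, l.
have QltP : Q `<` P by split => // PQ; apply: nQz; exact: PQ.
have nhQ : ~ htge (size y).+1 Q by move=> hQ; apply: hP; split => //; exists Q.
have [eQ|neQ] := pselect (exc y Q); last first.
  have [t [nQt bt]] := IHy Q pQ nhQ neQ w0.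
  by case: nQt; apply: AQ; apply/AP.
case: eP; split => //; exists Q; split => // P' pP' QP' P'z P'P.
apply: contrapT => nPP'; apply: hP; split => //; exists P'; last by split.
split => //; exists Q; first exact: exc_htge.
by split => // P'Q; apply: nQz; exact: P'Q.
Qed.

(** The annihilator of a class contains powers of the elements of [y], hence, at
[P], a power of each [g] in [a]: otherwise there is a prime [Q] below [P] that
contains [y] but not [g], and it is strictly below [P], so of height less than
[size y]. *)
Lemma cech_a_torsion X y P (a : submodClosed R^o) :
  prime_set P -> ~ htge (size y).+1 P -> (forall r : R^o, r \in a -> P r) ->
  (forall Q, prime_set Q -> (forall z, z \in y -> Q z) -> ~ htge (size y) Q ->
    forall r : R^o, r \in a -> Q r) ->
  forall s (x : caug (cech X y) s), del (cech X y) s x = 0 ->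
  exists t k, outside P t /\
    forall r : R^o, r \in ideal_exp a k -> bnd ((r : R) *: (t *: x)).
Proof.
move=> pP hP aP yQ s x dx; have [A AP] := ann_bnd x.
have [gs gsE] := noethR a.
have ag g : g \in a -> exists t N,
    outside P t /\ ((t * (g : R) ^+ N : R) : R^o) \in A.
  move=> ga; apply: contrapT => ng.
  have [||Q [pQ AQ QP nQg]] := @prime_under P A g.
  - exact: pP.
  - by move=> t N Pt; apply/negP => tA; apply: ng; exists t, N.
  apply: (nQg); apply: (yQ Q) => //.
    move=> z zy; have [k bz] := cech_torsion zy dx.
    by apply: (prime_setX (k := k)) => //; apply: AQ; apply/AP.
  move=> hQ; apply: hP; split => //; exists Q => //; split => // PQ.
  by apply: nQg; apply: PQ; exact: aP.
have [t [Pt tA]] : exists t, outside P t /\ forall g, g \in gs ->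
    exists N, ((t * (g : R) ^+ N : R) : R^o) \in A.
  have : forall g, g \in gs -> g \in a by move=> g ggs; rewrite gsE; exact: mem_span.
  elim: (gs) => [|g l IHl] la; first by exists 1; split=> //; exact: outside1.
  have [|t [Pt tA]] := IHl; first by move=> h hl; apply: la; rewrite inE hl orbT.
  have [u [N [Pu uA]]] := ag g (la g (mem_head _ _)).
  exists (u * t); split=> [|h]; first exact: outsideM.
  rewrite inE => /predU1P[->|/tA[M tM]].
    by exists N; rewrite mulrAC mulrC; exact: ideal_mull.
  by exists M; rewrite -mulrA; exact: ideal_mull.
(* Up to [t], the annihilator contains powers of all generators of [a]. *)
have [B BP] := ann_bnd (t *: x).
have [||k kB] := @ideal_exp_sub R noethR a gs B.
- by move=> r; rewrite gsE.
- move=> g /tA[N gN]; exists N; apply/BP; rewrite scalerA mulrC.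
  exact/AP.
by exists t, k; split=> // r /kB/BP.
Qed.

End Local.

(** * Generalized local cohomology at a prime *)

Section GenLocal.
Variable R : comNzRingType.
Hypothesis noethR : noetherian R.
Implicit Types (X Y D M : lmodType R) (P Q : set R) (a : submodClosed R^o).

Lemma ideal_exp_pow a k (r : R) :
  (r : R^o) \in a -> (r ^+ k : R^o) \in ideal_exp a k.
Proof.
move=> ra; elim: k => [|k IHk]; first exact: sub_span.
by apply: sub_span; exists r, (r ^+ k); rewrite exprS.
Qed.

Definition adic_quot a M k : lmodType R :=
  quot_type (ideal_smul (ideal_exp a k) M).

Lemma adic_quot_ann a M k (r : R) (u : adic_quot a M k) :
  (r : R^o) \in ideal_exp a k -> r *: u = 0.
Proof.
move=> ra; rewrite -(quot_projK u) -quot_projZ; apply/eqP.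
rewrite -[0](linear0 (quot_proj (ideal_smul (ideal_exp a k) M))) quotP subr0.
by apply: sub_span; exists r, (repr u).
Qed.

Lemma adic_quot_fin_gen a M k : fin_gen M -> fin_gen (adic_quot a M k).
Proof.
apply: (fin_gen_im (f := quot_proj (ideal_smul (ideal_exp a k) M))) => w.
by exists (repr w); exact: quot_projK.
Qed.

Lemma fin_gen_regular : fin_gen (R^o : lmodType R).
Proof.
exists [:: (1 : R^o)] => x.
have -> : x = (x : R) *: (1 : R^o) by rewrite /GRing.scale/= mulr1.
by apply: rpredZ; apply: mem_span; exact: mem_head.
Qed.

Section Sys.
Variable a : submodClosed R^o.
Let pi := @std_sys R (adic_quot a R^o) (adic_proj a R^o).

Lemma sys_map_one d k :
  sys_map (D := fun k => std_res (adic_quot a R^o k)) pi 0 d k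
    << quot_proj (ideal_smul (ideal_exp a (d + k)) R^o) 1 >> =
  << quot_proj (ideal_smul (ideal_exp a k) R^o) 1 >>.
Proof.
elim: d => [//|d IHd]; rewrite -[RHS]IHd /=.
apply: (congr1 (sys_map pi 0 d k)); rewrite free_mapU; congr (<< _ >>).
exact: quot_map_proj.
Qed.

(** An element of [Y] killed by a^k is the value at 1 of a map from R / a^k,
which dies in the limit up to [T]. *)
Lemma lim_ext_tors0 (T : set R) Y : lim_ext_tors T pi 0 Y ->
  forall (y : Y) k, (forall r : R, (r : R^o) \in ideal_exp a k -> r *: y = 0) ->
  exists t, T t /\ t *: y = 0.
Proof.
move=> limY y k ay.
have yl : linear (fun r : R^o => (r : R) *: y).
  by move=> c u v; rewrite scalerDl scalerA.
have [f fE] : exists f : {linear adic_quot a R^o k -> Y},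
    forall r : R^o, f (quot_proj (ideal_smul (ideal_exp a k) R^o) r) = (r : R) *: y.
  apply: (lin_factor (g := mk_linear yl)) => [w|r r0].
    by exists (repr w); exact: quot_projK.
  have rI : r \in ideal_smul (ideal_exp a k) R^o.
    by rewrite -[r]subr0 -quotP; apply/eqP; rewrite r0 linear0.
  suff : r \in lin_ker (mk_linear yl) by move=> /mkSubmodP.
  move: r rI {r0}; apply: span_sub => _ [c [x [ca ->]]]; apply/mkSubmodP.
  by change (((c : R) * (x : R)) *: y = 0); rewrite mulrC -scalerA ay// scaler0.
have [|t [d [Tt tf]]] := limY k (f \o @free_aug R (adic_quot a R^o k)).
  move=> x /=; have -> : free_aug (pdiff (std_res (adic_quot a R^o k)) 0 x) = 0.
    exact: lin_ker_val.
  by rewrite linear0.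
pose one l := quot_proj (ideal_smul (ideal_exp a l) R^o) 1.
have yE : f (free_aug << one k >>) = y by rewrite free_augU fE scale1r.
exists t; split => //; rewrite -yE -(sys_map_one d k).
exact: (tf << one (d + k)%N >>).
Qed.

End Sys.

(** If [a] is not contained in [P], an element of M / a^k M is killed by r^k for
some [r] in [a] outside [P].  Otherwise the Cech complex on [y] resolves [X] at
[P]: below degree [size y] by the assumption on local cohomology, in degree
[size y] because [P] is not exceptional. *)
Lemma gen_local_cohomology_tors (X M : lmodType R) a y P :
  fin_gen M -> prime_set P -> ~ htge (size y).+1 P -> ~ exc y P ->
  (forall z : R^o, z \in y -> z \in a) ->
  (forall Q, prime_set Q -> (forall z, z \in y -> Q z) -> ~ htge (size y) Q ->
    forall r : R^o, r \in a -> Q r) ->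
  (forall j, (j < size y)%N -> forall h : local_cohomology a j X, h = 0) ->
  forall i, tors (outside P) (gen_local_cohomology a i M X).
Proof.
move=> fgM pP hP eP ya yQ lcX i.
have T1 := outside1 pP; have TM s t := @outsideM R P s t pP.
suff extX k j : ext_tors (outside P) j (std_res (adic_quot a M k)) X.
  by apply: tors_dlim => k; exact/tors_Ext/extX.
have [aP|naP] := pselect (forall r : R^o, r \in a -> P r); last first.
  have [r ra nPr] : exists2 r : R^o, r \in a & ~ P r.
    apply: contrapT => nr; apply: naP => r ra; apply: contrapT => nPr.
    by apply: nr; exists r.
  have rkP : outside P (r ^+ k) by move=> /(prime_setX pP).
  have rk0 := fun z => @adic_quot_ann a M k _ z (ideal_exp_pow k ra).
  exact: (@ext_tors_ann R (outside P) (adic_quot a M k) X (r ^+ k) j rkP rk0).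
have acK N l s : acyclic (std_res (adic_quot a N l)) (cobj (cech X y) s).
  apply: cech_acyclic => z zy; exists l => w; apply: adic_quot_ann.
  by apply: ideal_exp_pow; exact: ya.
have fgT N l Y j' : fin_gen N -> tors (outside P) Y ->
    ext_tors (outside P) j' (std_res (adic_quot a N l)) Y.
  move=> fgN tY; apply: ext_tors_fin_gen => //; exact: adic_quot_fin_gen.
have exK s : exact_tors (outside P) (cech X y) s.
  have [sy|] := ltnP s (size y).
    apply: (@exact_tors_lim R (outside P) TM (fun l => std_res (adic_quot a R^o l))
      (@std_sys R (adic_quot a R^o) (adic_proj a R^o)) _ _
      (fun l => [set r : R | (r : R^o) \in ideal_exp a l]) _ X (cech X y) (size y)
      _ _ _ s sy).
    - exact: std_sys_diff.
    - by move=> l V tV j'; apply: fgT => //; exact: fin_gen_regular.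
    - by move=> Y limY v l av; exact: lim_ext_tors0 av.
    - by move=> l s' j'; apply: acyclic_ext_tors => //; exact: acK.
    - by move=> s' x dx; exact: (cech_a_torsion noethR pP hP aP yQ dx).
    - by move=> j' jy; apply: lim_ext_tors_dlim => //; exact: lcX.
  rewrite leq_eqVlt => /predU1P[<-|]; first by move=> x _; exact: cech_top.
  case: s => // s sy x _; exists 1; split => //.
  by rewrite (@cech_bound R X y s x sy) scaler0; exact: bnd0.
apply: (@ext_tors_coresolution R (outside P) TM (std_res (adic_quot a M k)) X
  (cech X y) (size y) _ _ exK _ j).
- by move=> V tV j'; exact: fgT.
- by move=> s j'; apply: acyclic_ext_tors => //; exact: acK.
- by move=> s c; exact: cech_bound.
Qed.

End GenLocal.

(** * Local rings *)

Section LocalRing.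
Variable R : comNzRingType.
Hypothesis noethR : noetherian R.

Lemma proper_idealr (I : submodClosed R^o) : (1 : R^o) \notin I ->
  exists J : idealr R, forall r : R, r \in J <-> (r : R^o) \in I.
Proof.
move=> I1; pose p (r : R) := (r : R^o) \in I.
have pI : idealr_closed p.
  split=> [||a u v pu pv]; [exact: (rpred0 I)|exact: I1|].
  by apply: (@rpredD _ I) => //; exact: ideal_mull.
by exists (HB.pack_for (idealr R) p (isIdealr.Build R p pI)).
Qed.

Variable m : idealr R.
Hypothesis local_m : local_ring m.

Lemma prime_set_sub_maximal P : prime_set P -> P `<=` [set` m].
Proof.
move=> pP; have [I IP] := prime_set_submod pP.
have [|J [[IJ J1] maxJ]] := @noetherian_max R noethR (fun J =>
    {subset I <= J} /\ (1 : R^o) \notin J).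
  by exists I; split => //; apply/negP => /IP/(prime1 pP).
have [J' J'J] := proper_idealr J1.
have maxJ' : maximal_ideal J'.
  move=> L J'L x Lx; apply/J'J.
  pose Q := [set r : R^o | (r : R) \in L].
  have Q0 : Q 0 by exact: idealr0.
  have QD u v : Q u -> Q v -> Q (u + v) by exact: rpredD.
  have QZ (c : R) u : Q u -> Q (c *: u) by exact: idealMr.
  apply: (maxJ (mkSubmod Q0 QD QZ)).
  - split=> [r /IJ rJ|]; first by apply/(mkSubmodP Q0 QD QZ)/J'L/J'J.
    by apply/negP => /(mkSubmodP Q0 QD QZ); rewrite /Q /= idealr1.
  - by move=> r rJ; apply/(mkSubmodP Q0 QD QZ)/J'L/J'J.
  - exact/(mkSubmodP Q0 QD QZ).
move=> r Pr /=; have [_ /(_ J' maxJ') <-] := local_m.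
by apply/J'J/IJ/IP.
Qed.

(** By separation some prime contains [m]; it is contained in [m]. *)
Lemma maximal_prime_set : prime_set [set` m].
Proof.
pose Q := [set r : R^o | (r : R) \in m].
have Q0 : Q 0 by exact: idealr0.
have QD u v : Q u -> Q v -> Q (u + v) by exact: rpredD.
have QZ (c : R) u : Q u -> Q (c *: u) by exact: idealMr.
have [|||P [pP mP _]] := @prime_separation R noethR (mkSubmod Q0 QD QZ) [set 1].
- by [].
- by move=> s t -> ->; rewrite mulr1.
- move=> t ->; apply/negP => /(mkSubmodP Q0 QD QZ).
  by rewrite /Q /= idealr1.
suff <- : P = [set` m] by [].
apply/seteqP; split; first exact: prime_set_sub_maximal.
by move=> r rm; apply: mP; exact/(mkSubmodP Q0 QD QZ).
Qed.

End LocalRing.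

Theorem corollary3p13 (R : comNzRingType) (m : idealr R) (n : nat)
    (a : submodClosed R^o) (M X : lmodType R) :
  noetherian R -> local_ring m -> krull_dim R n ->
  fin_gen M ->
  (forall j : nat, j.+1 <> n -> j <> n ->
     forall h : local_cohomology a j X, h = 0) ->
  forall i : nat, finite_set (Ass (gen_local_cohomology a i M X)).
Proof.
move=> noethR local_m [_ dimR] fgM lcX i.
have [y [sy ya yQ]] := exists_parameters noethR a n.-1.
apply: (@sub_finite_set _ _ ([set [set` m]] `|` exc y)); last first.
  by rewrite finite_setU; split; [exact: finite_set1|exact: exc_finite].
move=> P [p [x [Pp Px]]].
have pP : prime_set P by rewrite Pp; exact: prime_idealr_set.
have [Pm|nPm] := pselect (P = [set` m]); [by left|right].
have Plt : P `<` [set` m].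
  split; first exact: (prime_set_sub_maximal noethR local_m).
  move=> mP; apply: nPm; apply/seteqP; split => //.
  exact: (prime_set_sub_maximal noethR local_m).
have pm := maximal_prime_set noethR local_m.
(* A chain ending in P extends to m. *)
have hm d : htge d P -> (d < n)%N.
  move=> hP; have [|q [qc _]] := @htge_chain R d.+1 [set` m].
    by split => //; exists P.
  exact: dimR qc.
have n_gt0 : (0 < n)%N by exact: (hm 0%N pP).
apply: contrapT => neP.
have hP : ~ htge (size y).+1 P.
  by move=> /hm; rewrite sy prednK// ltnn.
have [||s [nPs sx]] := @gen_local_cohomology_tors R noethR X M a y P
    fgM pP hP neP ya _ _ i x.
- by rewrite sy.
- move=> j; rewrite sy => jn; apply: lcX => [jE|jE]; move: jn; rewrite -jE.
    by rewrite ltnn.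
  by rewrite ltnNge leq_pred.
by apply: nPs; rewrite Px.
Qed.
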